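(* Let $n\ge 1$, let $t$ and $y_1,\dots,y_n$ be fixed indeterminates, and define $$\mathcal{F}_n(x_1,\dots,x_n)=\sum_{\lambda} w_\lambda(n,t)\,P_\lambda(x_1,\dots,x_n;t)\,P_\lambda(y_1,\dots,y_n;t),\qquad w_\lambda(n,t)=\prod_{i=0}^{\infty}\prod_{j=1}^{m_i(\lambda)}(1-t^j),$$ the sum being over all partitions $\lambda$ of length at most $n$ (and $\mathcal{F}_{n-1}(x_1,\dots,x_{n-1})$ denotes the same function built with $n-1$ variables $x_1,\dots,x_{n-1}$ and $y_1,\dots,y_{n-1}$). Then: (1) $\mathcal{F}_n(x_1,\dots,x_n)$ is symmetric in $x_1,\dots,x_n$; (2) $\prod_{i,j=1}^{n}(1-x_iy_j)\,\mathcal{F}_n(x_1,\dots,x_n)$ is a polynomial in $x_n$ of degree $n-1$; (3) $\mathcal{F}_n\big|_{x_n=1/(t y_n)}=-t^n\,\mathcal{F}_{n-1}(x_1,\dots,x_{n-1})$; (4) $\mathcal{F}_1(x_1)=(1-t)/(1-x_1y_1)$.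
   Context: $P_\lambda(x_1,\dots,x_n;t)$ denotes the Hall–Littlewood polynomial (in Macdonald's normalization) indexed by the partition $\lambda$. For a partition $\lambda$ of length $\ell(\lambda)\le n$, $m_i(\lambda)$ for $i\ge1$ is the number of parts equal to $i$, and $m_0(\lambda)=n-\ell(\lambda)$ (the number of zeros appended to $\lambda$ to make it a vector of length $n$). Identities are understood as identities of formal power series / rational functions. *)

(* Defs.v *)
From HB Require Import structures.
From mathcomp Require Import all_boot all_order all_fingroup all_algebra.
From mathcomp Require Import mpoly.

Set Implicit Arguments.
Unset Strict Implicit.
Unset Printing Implicit Defensive.

Import GRing.Theory.
Local Open Scope ring_scope.

(* v_m(t) = \prod_(1 <= i <= m) (1 - t^i) / (1 - t)  and
   v_la(t) = \prod_(i >= 0) v_{m_i(la)}(t).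
   A partition of length at most n is a nonincreasing n-tuple of naturals, padded
   with zeros; so [count_mem i la] is m_i(la), also for i = 0.  Only the i
   occurring in [la] contribute to the products over all i >= 0. *)
Definition HLnorm (K : fieldType) (t : K) n (la : n.-tuple nat) : K :=
  \prod_(i <- undup la) \prod_(1 <= j < (count_mem i la).+1)
    ((1 - t ^+ j) / (1 - t)).

Definition weight (K : fieldType) (t : K) n (la : n.-tuple nat) : K :=
  \prod_(i <- undup la) \prod_(1 <= j < (count_mem i la).+1) (1 - t ^+ j).

(* Macdonald's symmetrization formula for P_la(x; t), a priori a rational
   function; [HL] below is the polynomial equal to it. *)
Definition HLfrac (K : fieldType) (t : K) n (la : n.-tuple nat) :
    {fraction {mpoly K[n]}} :=
  let X (i : 'I_n) : {fraction {mpoly K[n]}} := tofrac 'X_i in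
  let c (a : K) : {fraction {mpoly K[n]}} := tofrac a%:MP in
  c (HLnorm t la)^-1 *
  \sum_(w : 'S_n)
     (\prod_(i < n) X (w i) ^+ tnth la i) *
     \prod_(i < n) \prod_(j < n | (i < j)%N)
        ((X (w i) - c t * X (w j)) / (X (w i) - X (w j))).

Lemma det_eval_dvd (R : comNzRingType) n (a : 'rV[R]_n) (p : 'I_n -> {poly R}) :
  exists C : R,
    \det (\matrix_(i, j) (p i).[a 0 j]) = C * \det (Vandermonde n a).
Proof.
pose Q : {poly R} := \prod_(j < n) ('X - (a 0 j)%:P).
have mQ : Q \is monic by exact: monic_prod_XsubC.
have sQ : size Q = n.+1 by rewrite size_prod_XsubC /index_enum -enumT size_enum_ord.
pose r i := Pdiv.Ring.rmodp (p i) Q.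
have sr i : (size (r i) <= n)%N.
  by rewrite -ltnS -sQ Pdiv.Ring.ltn_rmodpN0 // monic_neq0.
exists (\det (\matrix_(i, k) (r i)`_k)); rewrite -det_mulmx; congr (\det _).
apply/matrixP => i j; rewrite !mxE.
rewrite [p i](Pdiv.RingMonic.rdivp_eq mQ) hornerD hornerM.
have -> : Q.[a 0 j] = 0.
  by rewrite horner_prod (bigD1 j) //= hornerXsubC subrr mul0r.
rewrite mulr0 add0r (horner_coef_wide _ (sr i)).
by apply: eq_bigr => k _; rewrite !mxE.
Qed.

Definition vdm (R : comNzRingType) n (x : 'I_n -> R) : R :=
  \prod_(i < n) \prod_(j < n | (i < j)%N) (x i - x j).

Lemma vdmE (R : comNzRingType) n (x : 'I_n -> R) :
  exists b : bool, forall s : 'S_n,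
    vdm (x \o s) = (-1) ^+ b * \det (Vandermonde n (\row_j x (s j))).
Proof.
exists (odd (\sum_(i < n) \sum_(j < n | (i < j)%N) 1)%N) => s.
rewrite det_Vandermonde signr_odd -prodrXr -big_split /=.
apply: eq_bigr => i _; rewrite -prodrXr -big_split /=.
by apply: eq_bigr => j _; rewrite !mxE expr1 mulN1r opprB.
Qed.

Lemma vdm_perm (R : comNzRingType) n (x : 'I_n -> R) (s : 'S_n) :
  vdm (x \o s) = (-1) ^+ s * vdm x.
Proof.
have [b vE] := vdmE x.
have -> : vdm x = vdm (x \o (1%g : 'S_n)).
  by apply: eq_bigr => i _; apply: eq_bigr => j _ /=; rewrite !perm1.
rewrite !vE mulrCA; congr (_ * _).
have -> : Vandermonde n (\row_j x (s j)) =
          col_perm s (Vandermonde n (\row_j x ((1%g : 'S_n) j))).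
  by apply/matrixP => i j; rewrite !mxE perm1.
by rewrite col_permE det_mulmx det_perm mulrC odd_permV.
Qed.

Lemma msymXU (R : comNzRingType) n (w : 'S_n) (i : 'I_n) :
  msym w ('X_i : {mpoly R[n]}) = 'X_(w i).
Proof.
rewrite msymX; congr mpolyX; apply/mnmP => j; rewrite !mnmE.
by rewrite -(inj_eq (@perm_inj _ w)) permKV.
Qed.

Lemma alternant_dvd (K : fieldType) n (g : {mpoly K[n]}) :
  exists h : {mpoly K[n]},
    \sum_(w : 'S_n) (-1) ^+ w * msym w g = h * vdm (fun i => 'X_i : {mpoly K[n]}).
Proof.
pose dv (f : {mpoly K[n]}) := exists h : {mpoly K[n]},
  f = h * vdm (fun i => 'X_i : {mpoly K[n]}).
elim/mpolyind: g => [|c m g _ _ [h IH]].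
  by exists 0; rewrite mul0r big1 // => w _; rewrite raddf0 mulr0.
have [b vE] := vdmE (fun i => 'X_i : {mpoly K[n]}).
have [C HC] := @det_eval_dvd {mpoly K[n]} n (\row_j 'X_j)
  (fun i => 'X^(m i)).
exists (c *: ((-1) ^+ b * C) + h).
have -> : \sum_(w : 'S_n) (-1) ^+ w * msym w (c *: 'X_[m] + g) =
  c *: (\sum_(w : 'S_n) (-1) ^+ w * msym w 'X_[m]) +
  \sum_(w : 'S_n) (-1) ^+ w * msym w g.
  rewrite scaler_sumr -big_split; apply: eq_bigr => w _ /=.
  by rewrite linearP /= mulrDr scalerAr.
rewrite IH mulrDl; congr (_ + _); rewrite -scalerAl; congr (_ *: _).
have := vE 1%g; rewrite [X in X = _](_ : _ = vdm (fun i => 'X_i : {mpoly K[n]})); last first.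
  by apply: eq_bigr => i _; apply: eq_bigr => j _ /=; rewrite !perm1.
move=> ->; rewrite mulrACA -signr_addb addbb mul1r.
have -> : \row_j 'X_((1%g : 'S_n) j) = \row_j 'X_j :> 'rV[{mpoly K[n]}]_n.
  by apply/rowP => j; rewrite !mxE perm1.
rewrite -HC; apply: eq_bigr => w _; congr (_ * _).
rewrite mpolyXE_id rmorph_prod /=; apply: eq_bigr => i _.
by rewrite !mxE rmorphXn /= msymXU hornerXn.
Qed.

Section HLpoly.
Variables (K : fieldType) (t : K) (n : nat) (la : n.-tuple nat).

Let Xp (i : 'I_n) : {mpoly K[n]} := 'X_i.

Definition HLnum : {mpoly K[n]} :=
  (\prod_(i < n) Xp i ^+ tnth la i) *
  \prod_(i < n) \prod_(j < n | (i < j)%N) (Xp i - t%:MP * Xp j).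

Lemma vdmX_neq0 : vdm Xp != 0.
Proof.
apply/prodf_neq0 => i _; apply/prodf_neq0 => j ij; rewrite subr_eq0.
apply/eqP => /(congr1 (mcoeff U_(i))); rewrite !mcoeffX eqxx.
have /negPf-> : U_(j)%MM != U_(i)%MM :> 'X_{1..n}.
  apply/eqP => /mnmP/(_ i); rewrite !mnmE eqxx.
  by case: eqP => // eji; rewrite eji ltnn in ij.
by move/eqP; rewrite oner_eq0.
Qed.

Lemma HLfracE :
  HLfrac t la * tofrac (vdm Xp) =
  tofrac ((HLnorm t la)^-1 *: \sum_(w : 'S_n) (-1) ^+ w * msym w HLnum).
Proof.
rewrite -mul_mpolyC rmorphM /= /HLfrac -mulrA; congr (_ * _).
rewrite mulr_suml rmorph_sum; apply: eq_bigr => w _ /=.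
have -> : \prod_(i < n) \prod_(j < n | (i < j)%N)
    ((tofrac (Xp (w i)) - tofrac t%:MP * tofrac (Xp (w j))) /
     (tofrac (Xp (w i)) - tofrac (Xp (w j)))) =
  tofrac (\prod_(i < n) \prod_(j < n | (i < j)%N)
            (Xp (w i) - t%:MP * Xp (w j))) / tofrac (vdm (Xp \o w)).
  rewrite !rmorph_prod -prodf_div; apply: eq_bigr => i _ /=.
  rewrite !rmorph_prod -prodf_div; apply: eq_bigr => j _ /=.
  by rewrite !rmorphB !rmorphM.
rewrite vdm_perm rmorphM rmorphXn rmorphN1 invfM -!mulrA mulVf; last first.
  by rewrite tofrac_eq0 vdmX_neq0.
rewrite mulr1 -signr_odd -exprVn invrN1 signr_odd rmorphM rmorphXn rmorphN1.
rewrite mulrA mulrC; congr (_ * _).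
rewrite /HLnum !rmorphM !rmorph_prod; congr (_ * _); apply: eq_bigr => i _ /=.
  by rewrite !rmorphXn /= msymXU.
rewrite !rmorph_prod; apply: eq_bigr => j _ /=.
by congr (tofrac _); rewrite !mul_mpolyC msymB msymZ !msymXU.
Qed.

Lemma HLfrac_poly : exists p : {mpoly K[n]}, tofrac p == HLfrac t la.
Proof.
have [h hE] := alternant_dvd HLnum.
exists ((HLnorm t la)^-1 *: h).
have nz : tofrac (vdm Xp) != 0 by rewrite tofrac_eq0 vdmX_neq0.
by rewrite -(inj_eq (mulIf nz)) HLfracE hE -rmorphM -scalerAl.
Qed.

Definition HL : {mpoly K[n]} := xchoose HLfrac_poly.

Lemma HLE : tofrac HL = HLfrac t la.
Proof. exact/eqP/(xchooseP HLfrac_poly). Qed.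

Lemma dhomog_bigprod I (r : seq I) (P : pred I) (F : I -> {mpoly K[n]}) d :
  (forall i, P i -> F i \is (d i).-homog) ->
  \prod_(i <- r | P i) F i \is (\sum_(i <- r | P i) d i)%N.-homog.
Proof.
move=> hF; elim/big_rec2: _ => [|i e p Pi hp]; first exact: dhomog1.
by apply: dhomogM => //; apply: hF.
Qed.

Lemma msym_dhomog d (p : {mpoly K[n]}) (w : 'S_n) :
  p \is d.-homog -> msym w p \is d.-homog.
Proof. by rewrite !homog_piE -msym_pihomog => /eqP->. Qed.

Lemma HL_homog : HL \is (\sum_(i < n) tnth la i)%N.-homog.
Proof.
set D := (\sum_(i < n) tnth la i)%N.
pose T := (\sum_(i < n) \sum_(j < n | (i < j)%N) 1)%N.
have hX i : Xp i \is 1.-homog by rewrite dhomogX /= mdeg1.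
have hV : vdm Xp \is T.-homog.
  apply: dhomog_bigprod => i _; apply: dhomog_bigprod => j _.
  by rewrite rpredB ?hX.
have hN : HLnum \is (D + T)%N.-homog.
  apply: dhomogM; apply: dhomog_bigprod => i _.
    by rewrite -[X in X.-homog]mul1n; apply: dhomogMn.
  apply: dhomog_bigprod => j _.
  by rewrite mul_mpolyC rpredB ?hX // dhomogZ ?hX.
have hH : HL * vdm Xp \is (D + T)%N.-homog.
  have -> : HL * vdm Xp =
      (HLnorm t la)^-1 *: \sum_(w : 'S_n) (-1) ^+ w * msym w HLnum.
    by apply/eqP; rewrite -tofrac_eq rmorphM /= HLE HLfracE.
  apply: dhomogZ; apply: rpred_sum => w _.
  by rewrite -signr_odd; case: odd; rewrite ?mulN1r ?mul1r ?rpredN msym_dhomog.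
have key d : d != D -> pihomog mdeg d HL = 0.
  move=> dD; apply/eqP; have /mulIf/inj_eq <- := vdmX_neq0; rewrite mul0r.
  have [N leN ltN] : exists2 N, (mmeasure mdeg HL <= N)%N & (d < N)%N.
    by exists (maxn (mmeasure mdeg HL) d.+1); rewrite ?leq_maxl ?leq_maxr.
  have := pihomog_ne0 (b := (d + T)%N) _ hH; rewrite eqn_add2r eq_sym dD.
  rewrite {1}(pihomog_partitionE leN) mulr_suml raddf_sum /=.
  rewrite (bigD1 (Ordinal ltN)) //= pihomog_dE; last first.
    by apply: dhomogM => //; exact: pihomogP.
  rewrite big1 ?addr0 => [->|e ne] //.
  rewrite (@pihomog_ne0 _ _ _ (e + T)%N) //; last first.
    by apply: dhomogM => //; exact: pihomogP.
  by rewrite eqn_add2r; apply: contra ne => /eqP eE; apply/eqP/val_inj.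
rewrite (pihomog_partitionE (leqnn (mmeasure mdeg HL))).
apply: rpred_sum => e _; have [->|/key->] := eqVneq (e : nat) D.
  exact: pihomogP.
exact: rpred0.
Qed.

End HLpoly.

(* Coefficient families: the formal power series in n variables over K. *)
Definition mps (K : fieldType) n := 'X_{1..n} -> K.

Definition mps_poly (K : fieldType) n (p : {mpoly K[n]}) : mps K n :=
  fun m => p@_m.

Definition mps_scale (K : fieldType) n (c : K) (f : mps K n) : mps K n :=
  fun m => c * f m.

Definition mps_mulp (K : fieldType) n (p : {mpoly K[n]}) (f : mps K n) :
    mps K n :=
  fun m => \sum_(k <- msupp p | (k <= m)%MM) p@_k * f (m - k)%MM.

Definition mps_symmetric (K : fieldType) n (f : mps K n) : Prop :=
  forall (s : 'S_n) (m : 'X_{1..n}), f [multinom m (s i) | i < n] = f m.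

(* f is the power series expansion of the rational function p / q. *)
Definition mps_frac (K : fieldType) n (f : mps K n) (p q : {mpoly K[n]}) : Prop :=
  q@_0%MM != 0 /\ mps_mulp q f =1 mps_poly p.

(* The degree in the last variable is at most d (resp. equal to d), the
   coefficients being power series in the other variables. *)
Definition deg_last_le (K : fieldType) n (f : mps K n.+1) (d : nat) : Prop :=
  forall m : 'X_{1..n.+1}, (d < m ord_max)%N -> f m = 0.

Definition deg_last (K : fieldType) n (f : mps K n.+1) (d : nat) : Prop :=
  deg_last_le f d /\ exists m : 'X_{1..n.+1}, m ord_max = d /\ f m != 0.

(* The value at x_{n+1} = a of a series of degree at most d in x_{n+1}. *)
Definition eval_last (K : fieldType) n (d : nat) (a : K) (f : mps K n.+1) :
    mps K n :=
  fun m => \sum_(k < d.+1) f (mnmwiden m + U_(ord_max) *+ k)%MM * a ^+ k.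

Definition mpoly_eval_last (K : fieldType) n (a : K) (p : {mpoly K[n.+1]}) :
    {mpoly K[n]} :=
  p \mPo [tuple (if unlift ord_max i is Some j then 'X_j else a%:MP) | i < n.+1].

(* f|_{x_{n+1} = a} = g, for a series f which is rational in x_{n+1}: writing
   f = N / q, with q a polynomial and N a polynomial in x_{n+1} over the power
   series in the other variables, g is N|_{x_{n+1} = a} / q|_{x_{n+1} = a}, the
   denominator being an invertible power series.  Thus g does not depend on
   the choice of q, and need not be obtainable by substituting in f termwise. *)
Definition subst_last (K : fieldType) n (f : mps K n.+1) (a : K) (g : mps K n) :
    Prop :=
  exists (q : {mpoly K[n.+1]}) (d : nat),
    [/\ deg_last_le (mps_mulp q f) d,
        (mpoly_eval_last a q)@_0%MM != 0 &
        mps_mulp (mpoly_eval_last a q) g =1 eval_last d a (mps_mulp q f)].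

(* The sum over the partitions of length at most n with parts at most d. *)
Definition Fpartial (K : fieldType) (t : K) n (y : 'I_n -> K) (d : nat) :
    {mpoly K[n]} :=
  \sum_(l : n.-tuple 'I_d.+1 | sorted geq (map_tuple val l))
    let la := map_tuple val l in
    (weight t la * (HL t la).@[y]) *: HL t la.

(* P_la(x) is homogeneous of degree |la|, so partitions with a part larger than
   mdeg m do not contribute to the coefficient of x^m in the infinite sum. *)
Definition Fseries (K : fieldType) (t : K) n (y : 'I_n -> K) : mps K n :=
  fun m => (Fpartial t y (mdeg m))@_m.

Lemma Fseries_sum (K : fieldType) (t : K) n (y : 'I_n -> K) (m : 'X_{1..n}) d :
  (mdeg m <= d)%N -> (Fpartial t y d)@_m = Fseries t y m.
Proof.
move=> Md; set M := mdeg m in Md *; rewrite /Fseries /Fpartial -/M !raddf_sum /=.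
pose G (la : n.-tuple nat) := (weight t la * (HL t la).@[y]) * (HL t la)@_m.
have Gz la i : (M < tnth la i)%N -> G la = 0.
  move=> lt; rewrite /G (dhomog_nemf_coeff (HL_homog t la)) ?mulr0 //.
  by rewrite -/M neq_ltn (leq_trans lt) // (bigD1 i) //= leq_addr.
transitivity (\sum_(l : n.-tuple 'I_d.+1 | sorted geq (map_tuple val l) &&
    [forall i, tnth l i < M.+1]%N) G (map_tuple val l)).
  rewrite big_mkcondr; apply: eq_bigr => l _; rewrite mcoeffZ -/(G _).
  case: ifPn => // /forallPn[i]; rewrite ltnS -ltnNge => lt.
  by apply: (Gz _ i); rewrite tnth_map.
pose up (l : n.-tuple 'I_M.+1) : n.-tuple 'I_d.+1 :=
  map_tuple (@inord d \o val) l.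
pose dn (l : n.-tuple 'I_d.+1) : n.-tuple 'I_M.+1 :=
  map_tuple (@inord M \o val) l.
have upE l : map_tuple val (up l) = map_tuple val l.
  apply/eq_from_tnth => i; rewrite !tnth_map /= inordK //.
  exact: leq_trans (ltn_ord _) _.
rewrite (reindex_onto up dn) /=; last first.
  move=> l /andP[_ /forallP h]; apply/eq_from_tnth => i; rewrite !tnth_map /=.
  by apply/val_inj; rewrite /= [in LHS]inordK inordK ?h.
apply: eq_big => [l|l _]; last by rewrite upE mcoeffZ.
rewrite -[RHS]andbT -[RHS]andbT; congr ((_ && _) && _).
- by have /(congr1 val) /= -> := upE l.
- apply/forallP => i; rewrite !tnth_map /= inordK //.
  exact: leq_trans (ltn_ord _) _.
- apply/eqP/eq_from_tnth => i; rewrite !tnth_map /=.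
  apply/val_inj; rewrite /= inordK inordK //; exact: leq_trans (ltn_ord _) _.
Qed.

(* The indeterminates t, y_1, ..., y_n over the field k. *)
Definition tvar (k : fieldType) n : {fraction {mpoly k[n.+1]}} :=
  tofrac 'X_ord0.

Definition yvar (k : fieldType) n (i : 'I_n) : {fraction {mpoly k[n.+1]}} :=
  tofrac 'X_(lift ord0 i).

(* Main.v *)
(* Write A_I(x) = \prod_(i in I, j notin I) (x_i - t x_j) / (x_i - x_j).  Sorting the
   partitions by their number r of positive parts and removing the first column of
   the diagram gives the recursion
     F_n(x; y) = \sum_(#|I| = #|J| = r)
                   (t; t)_(n - r) A_I(y) A_J(x) y_I x_J F_r(x_J; y_I).
   The rational function
     G_n(x; y) = \sum_K (-t)^(n - #|K|) t^C(n - #|K|, 2) A_K(y)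
                   \prod_(j in K, i) (1 - t x_i y_j) / (1 - x_i y_j)
   satisfies the same recursion: after clearing denominators, both sides are
   polynomials in one of the x_e that agree at 0, at the 1 / y_j and at the other x_i,
   and these points outnumber the degree.  Marking the degree in x by an auxiliary
   variable, the recursion determines the power series F_n, so F_n = G_n.  In G_n the
   A_K(y) do not depend on x, hence \prod_(i, j) (1 - x_i y_j) G_n is a polynomial in x.
   Its coefficient of x_n^n is a multiple of a sum of the same kind with one x fewer,
   which vanishes; and at x_n = 1 / (t y_n) only the K that do not contain n survive. *)
Require Import Defs.
From mathcomp Require Import ring.
From mathcomp Require Import all_boot all_order all_fingroup all_algebra.
From mathcomp Require Import mpoly.

Set Implicit Arguments.
Unset Strict Implicit.
Unset Printing Implicit Defensive.

Import GRing.Theory.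
Local Open Scope ring_scope.

(** The count of interpolation points is tight, and this shapes the induction. After clearing
    denominators in one of the x, the naive degree bound equals the number of known zeros. The
    missing unit is gained from the top coefficients, which are multiples of [kernel 1 I J] with
    #|J| < #|I|. These vanish by the recursion itself at u = 1, since (1; t)_l = 0 for l > 0. Hence
    the recursion is proved for all u and for sets of different sizes at once; the same vanishing
    later bounds the degree in x_n by n - 1. That this degree is attained is seen by counting zeros
    along a line of special points, where at most two terms of the numerator survive. The passage to
    power series needs no limit: the identities are stated modulo a power of the degree marker.
    Coefficients in x are recovered through an injection of the polynomial ring into a field, where
    the quotients in A_K make sense. *)

Section Subsets.
Variables (T : finType).
Implicit Types (A K : {set T}) (p : T).

Lemma setDU1l A K p : p \notin K -> (p |: A) :\: K = p |: (A :\: K).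
Proof.
move=> pK; apply/setP=> i; rewrite !inE.
by case: eqP => [->|]; rewrite ?(negPf pK) ?andbF.
Qed.

Lemma setDU11 A K p : p \notin A -> (p |: A) :\: (p |: K) = A :\: K.
Proof.
move=> pA; apply/setP=> i; rewrite !inE.
by case: eqP => [->|]; rewrite ?(negPf pA) ?andbF.
Qed.

Lemma notin_subset A K p : p \notin A -> K \subset A -> p \notin K.
Proof. by move=> pA /subsetP KA; apply: contra pA; apply: KA. Qed.

Lemma notin_setDr A K p : p \notin A -> p \notin A :\: K.
Proof. by move=> pA; apply: notin_subset pA (subsetDl _ _). Qed.

Lemma cardsDK A K : K \subset A -> (#|K| + #|A :\: K|)%N = #|A|.
Proof. by move=> /setIidPr KA; rewrite -{1}KA cardsID. Qed.

Lemma big_subsetU1 (R : nmodType) (f : {set T} -> R) A p : p \notin A ->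
  \sum_(K : {set T} | K \subset p |: A) f K =
  \sum_(K : {set T} | K \subset A) (f K + f (p |: K)).
Proof.
move=> pA; rewrite big_split /= (bigID (fun K : {set T} => p \notin K)) /=.
congr (_ + _); first apply: eq_bigl => K.
  apply/andP/idP => [[/subsetP KA pK]|KA]; last first.
    by split; [apply: subset_trans KA (subsetUr _ _) | apply: notin_subset KA].
  apply/subsetP=> i iK; have := KA i iK; rewrite !inE => /orP[/eqP ip|//].
  by rewrite ip (negPf pK) in iK.
rewrite (reindex_onto (fun K => p |: K) (fun K => K :\ p)) /=; last first.
  by move=> K /andP[_]; rewrite negbK; apply: setD1K.
apply: eq_bigl => K; rewrite !inE eqxx /= andbT.
apply/andP/idP => [[/subsetP KA /eqP pK]|KA].
  apply/subsetP=> i iK; have := KA i; rewrite !inE iK orbT => /(_ isT).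
  case/orP=> // /eqP ip; move: iK; rewrite ip -pK !inE eqxx //.
by split; [apply: setUS | rewrite setU1K // (notin_subset pA KA)].
Qed.

Lemma big_setDK (R : comPzRingType) A K (f : T -> R) : K \subset A ->
  \prod_(j in A) f j = \prod_(j in A :\: K) f j * \prod_(j in K) f j.
Proof.
move=> /setIidPr KA; rewrite [LHS](bigID (mem K)) /= mulrC; congr (_ * _).
  by apply: eq_bigl => i; rewrite inE andbC.
by apply: eq_bigl => i; rewrite -[in RHS]KA inE.
Qed.

End Subsets.

(** * Interpolation identities *)

Section Lin.
Variable F : fieldType.

Definition lin (a b : F) : {poly F} := a%:P + b *: 'X.

Lemma horner_lin a b y : (lin a b).[y] = a + b * y.
Proof. by rewrite !hornerE. Qed.

Lemma horner_prod_lin (S : finType) (A : {set S}) (a b : S -> F) y :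
  (\prod_(i in A) lin (a i) (b i)).[y] = \prod_(i in A) (a i + b i * y).
Proof. by rewrite horner_prod; apply: eq_bigr => i _; rewrite horner_lin. Qed.

Lemma sizeM_leq (p q : {poly F}) a b c : (size p <= a.+1)%N -> (size q <= b.+1)%N ->
  (a + b <= c)%N -> (size (p * q)%R <= c.+1)%N.
Proof.
move=> pa qb abc; apply: leq_trans (size_polyMleq _ _) _.
by rewrite -subn1 leq_subLR add1n; move: (leq_add pa qb); rewrite addSn addnS;
  move=> /leq_trans; apply; rewrite !ltnS.
Qed.

Lemma size_lin a b : (size (lin a b) <= 2)%N.
Proof.
rewrite (leq_trans (size_polyD _ _)) // geq_max size_polyC.
by rewrite (leq_trans (size_scale_leq _ _)) ?size_polyX // andbT; case: eqP.
Qed.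

Lemma coef_prod_lin (S : finType) (A : {set S}) (a b : S -> F) :
  (\prod_(i in A) lin (a i) (b i))`_#|A| = \prod_(i in A) b i.
Proof.
rewrite cardE -!big_enum /=.
suff [] : (size (\prod_(i <- enum A) lin (a i) (b i))%R <= (size (enum A)).+1)%N /\
    (\prod_(i <- enum A) lin (a i) (b i))`_(size (enum A)) = \prod_(i <- enum A) b i.
  by [].
elim: (enum A) => [|i s [IH1 IH2]]; first by rewrite !big_nil size_poly1 coef1.
rewrite !big_cons /=; set p := \big[_/_]_(_ <- _) _ in IH1 IH2 *.
split; first by rewrite (@sizeM_leq _ _ 1 (size s)) ?size_lin.
rewrite /lin mulrDl mul_polyC -scalerAl coefD !coefZ coefXM /= IH2.
by rewrite (nth_default _ IH1) mulr0 add0r.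
Qed.

Lemma size_prod_lin (S : finType) (A : {set S}) (a b : S -> F) :
  (size (\prod_(i in A) lin (a i) (b i))%R <= #|A|.+1)%N.
Proof.
apply: leq_trans (size_poly_prod_leq _ _) _; rewrite leq_subLR addnS ltnS.
have h : (\sum_(i in A) size (lin (a i) (b i)) <= \sum_(i in A) 2)%N.
  by apply: leq_sum => i _; exact: size_lin.
by apply: leq_trans h _; rewrite sum_nat_const muln2 -addnn; apply: leqnn.
Qed.

End Lin.

Section Cross.
Variables (F : fieldType) (t : F) (T : finType) (x : T -> F).
Implicit Types (A B I J K : {set T}).

Definition cross I J : F :=
  \prod_(i in I) \prod_(j in J) ((x i - t * x j) / (x i - x j)).

Lemma cross0l J : cross set0 J = 1.
Proof. by rewrite /cross big_set0. Qed.

Lemma cross0r I : cross I set0 = 1.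
Proof. by rewrite /cross big1 // => i _; rewrite big_set0. Qed.

Lemma crossU1l p I J : p \notin I ->
  cross (p |: I) J = \prod_(j in J) ((x p - t * x j) / (x p - x j)) * cross I J.
Proof. by move=> pI; rewrite /cross big_setU1. Qed.

Lemma crossU1r p I J : p \notin J ->
  cross I (p |: J) = \prod_(i in I) ((x i - t * x p) / (x i - x p)) * cross I J.
Proof.
by move=> pJ; rewrite /cross -big_split; apply: eq_bigr => i _; rewrite big_setU1.
Qed.

Hypothesis x_inj : injective x.
Hypothesis x_neq0 : forall i, x i != 0.

Lemma subx_neq0 i j : i != j -> x i - x j != 0.
Proof. by move=> ij; rewrite subr_eq0 (inj_eq x_inj). Qed.

Lemma prod_cross_cancel p J : p \notin J ->
  \prod_(j in J) ((x p - t * x j) / (x p - x j)) * \prod_(j in J) (x p - x j) =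
  \prod_(j in J) (x p - t * x j).
Proof.
move=> pJ; rewrite -big_split; apply: eq_bigr => j jJ /=.
by rewrite divfK // subx_neq0 //; apply: contra pJ => /eqP->.
Qed.

Lemma prod_cross_cancelN p J : p \notin J ->
  \prod_(j in J) ((x j - t * x p) / (x j - x p)) * \prod_(j in J) (x p - x j) =
  \prod_(j in J) (t * x p - x j).
Proof.
move=> pJ; rewrite -big_split; apply: eq_bigr => j jJ /=.
rewrite -[x p - x j]opprB mulrN divfK ?opprB // subx_neq0 //.
by apply: contra pJ => /eqP<-.
Qed.

Definition cross_sum (c : nat -> F) A : F :=
  \sum_(K : {set T} | K \subset A) c #|A :\: K| * cross K (A :\: K).

(* As a function of x_p, the difference of the two sides times
   \prod_(j in A) (x_p - x_j) is a polynomial of degree at most #|A| vanishing at 0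
   and at the x_j, the poles at x_p = x_j cancelling in pairs. *)
Lemma cross_sumU1 c A p : p \notin A ->
  cross_sum c (p |: A) = cross_sum (fun l => t ^+ l * c l + c l.+1) A.
Proof.
move=> pA; set c' := fun l => _.
(* ['X] stands for x_p; the two summands for each K come from the subsets p |: K and K of p |: A, in
   this order. *)
pose P : {poly F} := \sum_(K : {set T} | K \subset A) (cross K (A :\: K))%:P *
   ((c #|A :\: K|)%:P * (\prod_(j in A :\: K) lin (- (t * x j)) 1 *
                         \prod_(j in K) lin (- x j) 1) +
    (c #|A :\: K|.+1)%:P * (\prod_(j in A :\: K) lin (- x j) 1 *
                           \prod_(j in K) lin (- x j) t))
  - (cross_sum c' A)%:P * \prod_(j in A) lin (- x j) 1.
have PE Y : P.[Y] = \sum_(K : {set T} | K \subset A) cross K (A :\: K) *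
   (c #|A :\: K| * (\prod_(j in A :\: K) (Y - t * x j) *
                     \prod_(j in K) (Y - x j)) +
    c #|A :\: K|.+1 * (\prod_(j in A :\: K) (Y - x j) *
                        \prod_(j in K) (t * Y - x j)))
  - cross_sum c' A * \prod_(j in A) (Y - x j).
  rewrite /P hornerD hornerN horner_sum hornerM hornerC horner_prod_lin.
  congr (_ - _ * _); last first.
    by apply: eq_bigr => i _; rewrite mul1r addrC.
  apply: eq_bigr => K _; rewrite !(hornerM, hornerD, hornerC) !horner_prod_lin.
  by congr (_ * (_ * (_ * _) + _ * (_ * _))); apply: eq_bigr => i _;
    rewrite ?mul1r addrC.
have P0 : P = 0.
  apply: (@roots_geq_poly_eq0 _ _ (0 :: [seq x i | i <- enum A])).
  - rewrite /=; apply/andP; split.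
      (* At x_p = 0 the fractions involving p become t if p is in the subset and 1 otherwise, which
         is the origin of [t ^+ l * c l + c l.+1]. *)
      rewrite rootE PE mulr_suml subr_eq0; apply/eqP; apply: eq_bigr => K KA.
      rewrite (big_setDK _ KA) mulr0.
      under eq_bigr do rewrite sub0r -mulrN.
      rewrite big_split /= prodr_const.
      under [X in _ * (_ + _ * (X * _))]eq_bigr do rewrite sub0r.
      under [X in _ * (_ * (_ * X) + _)]eq_bigr do rewrite sub0r.
      under [X in _ * (_ + _ * (_ * X))]eq_bigr do rewrite sub0r.
      under [X in _ = _ * (X * _)]eq_bigr do rewrite sub0r.
      under [X in _ = _ * (_ * X)]eq_bigr do rewrite sub0r.
      rewrite /c'; ring.
    apply/allP => _ /mapP[f fA ->]; rewrite mem_enum in fA.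
    rewrite rootE PE (bigD1 f fA) /= subrr mul0r mulr0 subr0.
    rewrite -(setD1K fA); have := setD11 f A; move: (A :\ f) => B /negbT fB {fA}.
    rewrite big_subsetU1 // big1 ?eqxx // => K KB.
    have fK := notin_subset fB KB.
    have fD := notin_setDr K fB.
    rewrite setDU1l // setDU11 // !big_setU1 //= cardsU1 fD add1n crossU1r //.
    rewrite crossU1l //.
    rewrite subrr !mul0r !mulr0 addr0 add0r.
    have h1 := prod_cross_cancelN fK; have h2 := prod_cross_cancel fD.
    rewrite -h1 -h2; ring.
  - rewrite /= map_inj_uniq // enum_uniq andbT.
    by apply/mapP => -[i _] /eqP; rewrite eq_sym (negPf (x_neq0 i)).
  rewrite /= size_map -cardE.
  have sC (a : F) : (size a%:P <= 1)%N by rewrite size_polyC; case: eqP.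
  rewrite (leq_trans (size_polyD _ _)) // size_polyN geq_max; apply/andP; split.
    apply: (big_ind (fun p : {poly F} => (size p <= #|A|.+1)%N)).
    - by rewrite size_poly0.
    - by move=> p1 p2 h1 h2; rewrite (leq_trans (size_polyD _ _)) // geq_max h1.
    move=> K KA; apply: (@sizeM_leq _ _ _ 0 #|A|) => //.
    rewrite (leq_trans (size_polyD _ _)) // geq_max.
    by apply/andP; split; apply: (@sizeM_leq _ _ _ 0 #|A|) => //;
      apply: (@sizeM_leq _ _ _ #|A :\: K| #|K|); rewrite ?size_prod_lin //;
      rewrite addnC cardsDK.
  by apply: (@sizeM_leq _ _ _ 0 #|A|); rewrite ?size_prod_lin.
have := PE (x p); rewrite P0 horner0 => /esym/eqP; rewrite subr_eq0 => /eqP E.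
have nz : \prod_(j in A) (x p - x j) != 0.
  apply/prodf_neq0 => j jA; rewrite subx_neq0 //.
  by apply: contra pA => /eqP->.
apply: (mulIf nz); rewrite -E /cross_sum big_subsetU1 // mulr_suml.
apply: eq_bigr => K KA; rewrite (big_setDK _ KA).
have pK := notin_subset pA KA.
have pD := notin_setDr K pA.
rewrite setDU1l // setDU11 // cardsU1 pD add1n crossU1r // crossU1l //.
rewrite -(prod_cross_cancelN pK) -(prod_cross_cancel pD); ring.
Qed.

Lemma cross_sum0 c : cross_sum c set0 = c 0%N.
Proof.
rewrite /cross_sum (big_pred1 set0) => [|K]; last by rewrite subset0.
by rewrite setD0 cards0 cross0l mulr1.
Qed.

(** [qpoch u l] is the shifted factorial (u; t)_l, and [qcoef u l] is the factor of the Gaussian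
    binomial coefficient in its expansion by the q-binomial theorem. *)
Definition qcoef (u : F) l : F := (- u) ^+ l * t ^+ 'C(l, 2).
Definition qpoch (u : F) l : F := \prod_(i < l) (1 - u * t ^+ i).

Lemma eq_cross_sum c c' A : c =1 c' -> cross_sum c A = cross_sum c' A.
Proof. by move=> cc; apply: eq_bigr => K _; rewrite cc. Qed.

Lemma cross_sumZ a c A : cross_sum (fun l => a * c l) A = a * cross_sum c A.
Proof. by rewrite mulr_sumr; apply: eq_bigr => K _; rewrite mulrA. Qed.

Lemma cross_sumD c c' A :
  cross_sum (fun l => c l + c' l) A = cross_sum c A + cross_sum c' A.
Proof. by rewrite -big_split; apply: eq_bigr => K _; rewrite mulrDl. Qed.

Lemma qcoefS u l : qcoef u l.+1 = - u * t ^+ l * qcoef u l.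
Proof. by rewrite /qcoef binS bin1 exprS exprD; ring. Qed.

Lemma qcoefMt u l : t ^+ l * qcoef u l = qcoef (u * t) l.
Proof. by rewrite /qcoef -mulNr exprMn; ring. Qed.

(** Removing one element by [cross_sumU1] turns [qcoef u] into (1 - u) times [qcoef (u * t)], so
    each element yields one factor of the shifted factorial. *)
Lemma cross_sum_qcoef u A : cross_sum (qcoef u) A = qpoch u #|A|.
Proof.
move Dm: #|A| => m; elim: m u A Dm => [|m IH] u A Dm.
  move/eqP: Dm; rewrite cards_eq0 => /eqP->.
  by rewrite cross_sum0 /qpoch big_ord0 /qcoef mul1r bin0n expr0.
have [p pA] : exists p, p \in A by apply/set0Pn; rewrite -cards_eq0 Dm.
have Ap : #|A :\ p| = m by apply/eqP; rewrite -eqSS -Dm (cardsD1 p A) pA.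
rewrite -(setD1K pA) cross_sumU1 ?setD11 //.
rewrite (@eq_cross_sum _ (fun l => (1 - u) * qcoef (u * t) l)); last first.
  by move=> l; rewrite qcoefS -qcoefMt; ring.
rewrite cross_sumZ IH // /qpoch big_ord_recl expr0 mulr1; congr (_ * _).
by apply: eq_bigr => i _; rewrite /= exprS mulrA.
Qed.

Lemma cross_sum_card1 A :
  cross_sum (fun l => (l == 1%N)%:R) A = \sum_(i < #|A|) t ^+ i.
Proof.
move Dm: #|A| => m; elim: m A Dm => [|m IH] A Dm.
  move/eqP: Dm; rewrite cards_eq0 => /eqP->.
  by rewrite cross_sum0 big_ord0.
have [p pA] : exists p, p \in A by apply/set0Pn; rewrite -cards_eq0 Dm.
have Ap : #|A :\ p| = m by apply/eqP; rewrite -eqSS -Dm (cardsD1 p A) pA.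
rewrite -(setD1K pA) cross_sumU1 ?setD11 //.
rewrite (@eq_cross_sum _ (fun l => t * (l == 1%N)%:R + (l == 0%N)%:R)); last first.
  by move=> l; rewrite eqSS; case: (eqVneq l 1%N) => [->|_]; rewrite ?expr1 ?mulr0.
rewrite cross_sumD cross_sumZ IH // big_ord_recl expr0 addrC; congr (_ + _).
  rewrite /cross_sum (bigD1 (A :\ p)) //= setDv cards0 cross0r mulr1.
  rewrite big1 ?addr0 // => K /andP[KA KnA].
  have -> : (#|A :\ p :\: K| == 0%N) = false.
    by rewrite cards_eq0 setD_eq0; apply: contraNF KnA => AK; rewrite eqEsubset KA.
  by rewrite mul0r.
by rewrite big_distrr; apply: eq_bigr => i _; rewrite exprS.
Qed.

End Cross.

(** * The kernel and its column recursion *)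

Section Kernel.
Variables (F : fieldType) (t : F) (S T : finType) (a : S -> F) (b : T -> F).
Implicit Types (A I K : {set S}) (B J : {set T}).

Definition pairing A B : F :=
  \prod_(i in A) \prod_(j in B) ((1 - t * a i * b j) / (1 - a i * b j)).

(* [kernel t A B] is the candidate for F_n(a; b) when #|A| = #|B| = n.  The other
   values of [u] and of #|A|, #|B| are needed in the induction: [kernel 1] is, up to
   a factor, the limit of [kernel t] when one of the b_j tends to infinity. *)
Definition kernel u A B : F :=
  \sum_(K : {set S} | K \subset A)
    qcoef t u #|A :\: K| * cross t a K (A :\: K) * pairing K B.

(** Up to the factor \prod_(i in A) (1 - a_i Y), this is [kernel u A] with one more variable Y
    adjoined to B, as a polynomial in Y. *)
Definition kernel_poly u A B : {poly F} :=
  \sum_(K : {set S} | K \subset A)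
    (qcoef t u #|A :\: K| * cross t a K (A :\: K) * pairing K B)%:P *
    \prod_(i in A) lin 1 (- ((if i \in K then t else 1) * a i)).

(* The recursion obeyed by the sum over partitions: [I] and [J] carry the positive
   parts, and the first column of the diagram is removed. *)
Definition col_sum u A B : F :=
  \sum_(I : {set S} | I \subset A) \sum_(J : {set T} | J \subset B)
    (#|J| == #|I|)%:R *
    (qpoch t u #|A :\: I| * cross t a I (A :\: I) * cross t b J (B :\: J) *
     \prod_(i in I) a i * \prod_(j in J) b j * kernel t I J).

Lemma horner_kernel_poly u A B Y : (kernel_poly u A B).[Y] =
  \sum_(K : {set S} | K \subset A)
    qcoef t u #|A :\: K| * cross t a K (A :\: K) * pairing K B *
    (\prod_(i in A :\: K) (1 - a i * Y) * \prod_(i in K) (1 - t * a i * Y)).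
Proof.
rewrite horner_sum; apply: eq_bigr => K KA.
rewrite hornerM hornerC horner_prod_lin (big_setDK _ KA); congr (_ * (_ * _)).
  by apply: eq_bigr => i; rewrite inE => /andP[/negPf-> _]; rewrite mul1r mulNr.
by apply: eq_bigr => i ->; rewrite mulNr.
Qed.

Lemma kernel_poly0 u A B : (kernel_poly u A B).[0] = kernel u A B.
Proof.
rewrite horner_kernel_poly; apply: eq_bigr => K _.
by rewrite !big1 ?mulr1 // => i _; rewrite mulr0 subr0.
Qed.

(** The products contribute t ^+ #|K| to the top coefficient, and t ^+ #|K| * qcoef t t l = t ^+
    #|A| * qcoef t 1 l for l = #|A :\: K|: this is how u moves from t to 1. *)
Lemma coef_kernel_poly A B : (kernel_poly t A B)`_#|A| =
  t ^+ #|A| * \prod_(i in A) (- a i) * kernel 1 A B.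
Proof.
rewrite coef_sum mulr_sumr; apply: eq_bigr => K KA.
rewrite coefCM coef_prod_lin (big_setDK (fun i => - (_ * a i)) KA) /=.
have -> : \prod_(i in A :\: K) - ((if i \in K then t else 1) * a i) =
          \prod_(i in A :\: K) - a i.
  by apply: eq_bigr => i; rewrite inE => /andP[/negPf-> _]; rewrite mul1r.
have -> : \prod_(i in K) - ((if i \in K then t else 1) * a i) =
          \prod_(i in K) (t * - a i).
  by apply: eq_bigr => i ->; rewrite mulrN.
rewrite big_split /= prodr_const (big_setDK _ KA) -(cardsDK KA) exprD.
have /esym := qcoefMt t 1 #|A :\: K|; rewrite mul1r => ->; ring.
Qed.

Lemma size_kernel_poly u A B : (size (kernel_poly u A B) <= #|A|.+1)%N.
Proof.
apply: (big_ind (fun p : {poly F} => (size p <= #|A|.+1)%N)).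
- by rewrite size_poly0.
- by move=> p1 p2 h1 h2; rewrite (leq_trans (size_polyD _ _)) // geq_max h1.
move=> K KA; apply: (@sizeM_leq _ _ _ 0 #|A|); rewrite ?size_prod_lin //.
by rewrite size_polyC; case: eqP.
Qed.

Lemma size_kernel_poly_lt A B : kernel 1 A B = 0 ->
  (size (kernel_poly t A B) <= #|A|)%N.
Proof.
move=> k0; have := size_kernel_poly t A B; rewrite leq_eqVlt ltnS.
case/orP => // /eqP E; have := coef_kernel_poly A B; rewrite k0 mulr0.
have -> : (kernel_poly t A B)`_#|A| = lead_coef (kernel_poly t A B).
  by rewrite lead_coefE E.
by move/eqP; rewrite lead_coef_eq0 => /eqP p0; rewrite p0 size_poly0.
Qed.

Hypothesis a_inj : injective a.
Hypothesis a_neq0 : forall i, a i != 0.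
Hypothesis b_inj : injective b.
Hypothesis b_neq0 : forall j, b j != 0.
Hypothesis ab_neq1 : forall i j, a i * b j != 1.

Lemma sub1ab_neq0 i j : 1 - a i * b j != 0.
Proof. by rewrite subr_eq0 eq_sym ab_neq1. Qed.

(** Only the K containing p survive at Y = 1 / a_p, the others having the factor 1 - a_p Y. Up to
    normalization this is the residue of the extended kernel at its pole. *)
Lemma kernel_poly_pole u A B p : p \notin A ->
  (kernel_poly u (p |: A) B).[(a p)^-1] =
  (1 - t) * \prod_(i in A) (1 - t * a i / a p) * pairing [set p] B * kernel u A B.
Proof.
move=> pA; rewrite horner_kernel_poly big_subsetU1 // mulr_sumr.
apply: eq_bigr => K KA; have pK := notin_subset pA KA; have pD := notin_setDr K pA.
rewrite setDU1l // setDU11 // !big_setU1 //= divff ?a_neq0 // subrr !mul0r mulr0 add0r.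
rewrite crossU1l // (big_setDK _ KA) mulfK ?a_neq0 //.
rewrite /pairing big_setU1 // big_set1 /=.
have <- : \prod_(j in A :\: K) ((a p - t * a j) / (a p - a j)) *
    \prod_(j in A :\: K) (1 - a j / a p) = \prod_(j in A :\: K) (1 - t * a j / a p).
  rewrite -big_split; apply: eq_bigr => j jD /=; field.
  by rewrite a_neq0 subx_neq0 //; apply: contra pD => /eqP->.
ring.
Qed.

Lemma kernel_poly_b u A B e : e \notin B -> (kernel_poly u A B).[b e] =
  \prod_(i in A) (1 - a i * b e) * kernel u A (e |: B).
Proof.
move=> eB; rewrite horner_kernel_poly mulr_sumr; apply: eq_bigr => K KA.
rewrite (big_setDK _ KA) /pairing.
under [X in _ = _ * (_ * X)]eq_bigr do rewrite big_setU1 //=.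
rewrite [X in _ = _ * (_ * X)]big_split /=.
have <- : \prod_(i in K) ((1 - t * a i * b e) / (1 - a i * b e)) *
   \prod_(i in K) (1 - a i * b e) = \prod_(i in K) (1 - t * a i * b e).
  by rewrite -big_split; apply: eq_bigr => i _ /=; rewrite divfK // sub1ab_neq0.
ring.
Qed.

Lemma kernel0 u A : kernel u A set0 = qpoch t u #|A|.
Proof.
rewrite -(cross_sum_qcoef t a_inj a_neq0); apply: eq_bigr => K _.
have -> : pairing K set0 = 1 by rewrite /pairing big1 // => i _; rewrite big_set0.
by rewrite mulr1.
Qed.

Lemma kernel_set0 u : kernel u set0 set0 = 1.
Proof. by rewrite kernel0 cards0 /qpoch big_ord0. Qed.

Lemma col_sum0 u A : col_sum u A set0 = qpoch t u #|A|.
Proof.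
rewrite /col_sum (bigD1 set0) ?sub0set //= (big_pred1 set0) => [|K]; last first.
  by rewrite subset0.
rewrite !cards0 eqxx mul1r setD0 cross0l setD0 cross0l !big_set0 kernel_set0 !mulr1.
rewrite big1 ?addr0 // => I /andP[_ I0]; rewrite (big_pred1 set0) => [|K]; last first.
  by rewrite subset0.
by rewrite cards0 eq_sym cards_eq0 (negPf I0) mul0r.
Qed.

(** Since #|I| = #|J| is at most #|B|, the set I is always proper in A, and (1; t)_l has the factor
    1 - 1 for l > 0. *)
Lemma col_sum_eq0 A B : (#|B| < #|A|)%N -> col_sum 1 A B = 0.
Proof.
move=> BA; rewrite /col_sum big1 // => I IA; rewrite big1 // => J JB.
have [JI|] := eqVneq #|J| #|I|; last by rewrite mul0r.
have : (0 < #|A :\: I|)%N.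
  by rewrite -(ltn_add2l #|I|) cardsDK // addn0 -JI (leq_ltn_trans (subset_leq_card JB)).
case: #|A :\: I| => // l _.
by rewrite /qpoch big_ord_recl expr0 mulr1 subrr !mul0r mulr0.
Qed.

(* The difference between the two sides of [kernel_col_sum] for e |: B, with b_e
   replaced by 'X and the denominators cleared. *)
Definition interp_poly u A B : {poly F} :=
  \prod_(j in B) lin (- b j) 1 * kernel_poly u A B -
  \sum_(I : {set S} | I \subset A) \sum_(J : {set T} | J \subset B)
    (qpoch t u #|A :\: I| * cross t a I (A :\: I) * cross t b J (B :\: J) *
     \prod_(i in I) a i * \prod_(j in J) b j)%:P *
    (((#|J| == #|I|)%:R * kernel t I J)%:P *
     (\prod_(j in B :\: J) lin (- b j) 1 * \prod_(j in J) lin (- b j) t *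
      \prod_(i in A) lin 1 (- a i)) +
     (#|J|.+1 == #|I|)%:R%:P * 'X *
     (\prod_(j in B :\: J) lin (- (t * b j)) 1 * \prod_(j in J) lin (- b j) 1 *
      \prod_(i in A :\: I) lin 1 (- a i) * kernel_poly t I J)).

Lemma horner_interp_poly u A B Y : (interp_poly u A B).[Y] =
  \prod_(j in B) (Y - b j) * (kernel_poly u A B).[Y] -
  \sum_(I : {set S} | I \subset A) \sum_(J : {set T} | J \subset B)
    (qpoch t u #|A :\: I| * cross t a I (A :\: I) * cross t b J (B :\: J) *
     \prod_(i in I) a i * \prod_(j in J) b j) *
    ((#|J| == #|I|)%:R * kernel t I J *
     (\prod_(j in B :\: J) (Y - b j) * \prod_(j in J) (t * Y - b j) *
      \prod_(i in A) (1 - a i * Y)) +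
     (#|J|.+1 == #|I|)%:R * Y *
     (\prod_(j in B :\: J) (Y - t * b j) * \prod_(j in J) (Y - b j) *
      \prod_(i in A :\: I) (1 - a i * Y) * (kernel_poly t I J).[Y])).
Proof.
have P1 (B0 : {set T}) c d : (\prod_(j in B0) lin (- (d * b j)) c).[Y] =
    \prod_(j in B0) (c * Y - d * b j).
  by rewrite horner_prod_lin; apply: eq_bigr => j _; rewrite addrC.
have P1' (B0 : {set T}) c : (\prod_(j in B0) lin (- b j) c).[Y] =
    \prod_(j in B0) (c * Y - b j).
  by rewrite horner_prod_lin; apply: eq_bigr => j _; rewrite addrC.
have P2 (A0 : {set S}) : (\prod_(i in A0) lin 1 (- a i)).[Y] =
    \prod_(i in A0) (1 - a i * Y).
  by rewrite horner_prod_lin; apply: eq_bigr => j _; rewrite mulNr.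
rewrite /interp_poly hornerD hornerN hornerM P1' mul1r; congr (_ - _).
rewrite horner_sum; apply: eq_bigr => I _; rewrite horner_sum; apply: eq_bigr => J _.
by rewrite !(hornerM, hornerD, hornerC, hornerX) !P1 !P1' !P2 !mul1r.
Qed.

(** The summands containing [kernel_poly t I J] have naive degree #|A| + #|B| + 1, one too many.
    They occur only for #|J| < #|I|, where the hypothesis kills the top coefficient of
    [kernel_poly t I J]. *)
Lemma size_interp_poly u A B :
  (forall I J, J \subset B -> (#|J| < #|I|)%N -> kernel 1 I J = 0) ->
  (size (interp_poly u A B) <= (#|A| + #|B|).+1)%N.
Proof.
move=> k0; have sC (c : F) : (size c%:P <= 1)%N by rewrite size_polyC; case: eqP.
rewrite (leq_trans (size_polyD _ _)) // size_polyN geq_max; apply/andP; split.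
  apply: (@sizeM_leq _ _ _ #|B| #|A|);
    by rewrite ?size_prod_lin ?size_kernel_poly // addnC.
apply: (big_ind (fun p : {poly F} => (size p <= (#|A| + #|B|).+1)%N)).
- by rewrite size_poly0.
- by move=> p1 p2 h1 h2; rewrite (leq_trans (size_polyD _ _)) // geq_max h1.
move=> I IA; apply: (big_ind (fun p : {poly F} => (size p <= (#|A| + #|B|).+1)%N)).
- by rewrite size_poly0.
- by move=> p1 p2 h1 h2; rewrite (leq_trans (size_polyD _ _)) // geq_max h1.
move=> J JB; apply: (@sizeM_leq _ _ _ 0 (#|A| + #|B|)); [exact: sC | | by []].
have cA := cardsDK IA; have cB := cardsDK JB.
rewrite (leq_trans (size_polyD _ _)) // geq_max; apply/andP; split.
  apply: (@sizeM_leq _ _ _ 0 (#|B| + #|A|)); [exact: sC | | by rewrite add0n addnC].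
  apply: (@sizeM_leq _ _ _ #|B| #|A|); rewrite ?size_prod_lin //.
  by apply: (@sizeM_leq _ _ _ #|B :\: J| #|J|); rewrite ?size_prod_lin // addnC cB.
have [JI|] := eqVneq #|J|.+1 #|I|; last by rewrite !mul0r size_poly0.
rewrite mul1r; apply: (@sizeM_leq _ _ _ 1 (#|B| + #|A :\: I| + #|J|)).
- by rewrite size_polyX.
- apply: (@sizeM_leq _ _ _ (#|B| + #|A :\: I|) #|J|); last by [].
    apply: (@sizeM_leq _ _ _ #|B| #|A :\: I|); rewrite ?size_prod_lin //.
    by apply: (@sizeM_leq _ _ _ #|B :\: J| #|J|); rewrite ?size_prod_lin // addnC cB.
  by rewrite JI size_kernel_poly_lt // k0 // JI.
by rewrite -cA -JI -addnA addnCA add1n -addnS addnC [(#|A :\: I| + _)%N]addnC.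
Qed.

Lemma interp_poly_root0 u A B : kernel u A B = col_sum u A B ->
  root (interp_poly u A B) 0.
Proof.
move=> kc; rewrite rootE horner_interp_poly kernel_poly0 kc subr_eq0; apply/eqP.
rewrite mulr_sumr; apply: eq_bigr => I IA; rewrite mulr_sumr; apply: eq_bigr => J JB.
have -> : \prod_(i in A) (1 - a i * 0) = 1 by rewrite big1 // => i _; rewrite mulr0 subr0.
rewrite mulr0 (big_setDK _ JB); ring.
Qed.

(** Taking residues at 1 / a_p reduces both sides to the recursion without p. On the side of
    [col_sum], a term has this pole only if p lies in the first subset and the new variable in the
    second. *)
Lemma interp_poly_root_a u A B p : p \notin A -> kernel u A B = col_sum u A B ->
  root (interp_poly u (p |: A) B) (a p)^-1.
Proof.
move=> pA kc; have ap := a_neq0 p.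
rewrite rootE horner_interp_poly kernel_poly_pole // kc subr_eq0; apply/eqP.
rewrite big_subsetU1 // !mulr_sumr; apply: eq_bigr => I IA.
have pI := notin_subset pA IA; have pD := notin_setDr I pA.
rewrite setDU1l // setDU11 // !mulr_sumr -big_split; apply: eq_bigr => J JB /=.
rewrite !big_setU1 //= divff // subrr !(mul0r, mulr0, addr0, add0r).
rewrite cardsU1 pI add1n eqSS kernel_poly_pole // crossU1l //.
rewrite (big_setDK _ JB) (big_setDK _ IA) /pairing !big_set1 (big_setDK _ JB).
have -> : \prod_(j in B :\: J) ((a p)^-1 - t * b j) =
   \prod_(j in B :\: J) ((a p)^-1 - b j) *
   \prod_(j in B :\: J) ((1 - t * a p * b j) / (1 - a p * b j)).
  rewrite -big_split; apply: eq_bigr => j _ /=; field.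
  by rewrite ap sub1ab_neq0.
have <- : \prod_(j in A :\: I) ((a p - t * a j) / (a p - a j)) *
    \prod_(j in A :\: I) (1 - a j / a p) = \prod_(j in A :\: I) (1 - t * a j / a p).
  rewrite -big_split; apply: eq_bigr => j jD /=; field.
  by rewrite ap subx_neq0 //; apply: contra pD => /eqP->.
field.
by rewrite ap.
Qed.

(** When the new variable meets b_f, the poles of [cross] cancel in pairs: a second subset
    containing exactly one of the two is matched with the one where they are exchanged. *)
Lemma interp_poly_root_b u A B f : f \notin B -> root (interp_poly u A (f |: B)) (b f).
Proof.
move=> fB; rewrite rootE horner_interp_poly big_setU1 //= subrr !mul0r sub0r.
rewrite oppr_eq0.
rewrite big1 // => I IA; rewrite big_subsetU1 // big1 // => J JB.
have fJ := notin_subset fB JB; have fD := notin_setDr J fB.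
rewrite setDU1l // setDU11 // !big_setU1 //= subrr !(mul0r, mulr0, addr0, add0r).
rewrite cardsU1 fJ add1n crossU1r // crossU1l // kernel_poly_b // (big_setDK _ IA).
rewrite -(prod_cross_cancelN t b_inj fJ) -(prod_cross_cancel t b_inj fD); ring.
Qed.

Lemma interp_poly_eval u A B e : e \notin B ->
  (interp_poly u A B).[b e] = \prod_(j in B) (b e - b j) *
    \prod_(i in A) (1 - a i * b e) * (kernel u A (e |: B) - col_sum u A (e |: B)).
Proof.
move=> eB; rewrite horner_interp_poly kernel_poly_b // mulrBr mulrA; congr (_ - _).
rewrite mulr_sumr; apply: eq_bigr => I IA; rewrite big_subsetU1 // mulr_sumr.
apply: eq_bigr => J JB; have eJ := notin_subset eB JB; have eD := notin_setDr J eB.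
rewrite setDU1l // setDU11 // !big_setU1 //= cardsU1 eJ add1n crossU1r // crossU1l //.
rewrite kernel_poly_b // (big_setDK _ IA) (big_setDK _ JB).
rewrite -(prod_cross_cancelN t b_inj eJ) -(prod_cross_cancel t b_inj eD); ring.
Qed.

(** The induction on #|B| leaves u and A free: the zeros 1 / a_p use the recursion for A without p,
    and the degree bound uses it at u = 1 for pairs (I, J) with I larger than J. *)
Theorem kernel_col_sum u A B : kernel u A B = col_sum u A B.
Proof.
have [m] := ubnP #|B|; elim: m => // m IH in u A B *; rewrite ltnS => Bm.
have [->|[e eB]] := set_0Vmem B; first by rewrite kernel0 col_sum0.
move: Bm; rewrite -(setD1K eB); have := setD11 e B; move: (B :\ e) => B' /negbT eB'.
rewrite cardsU1 eB' add1n => Bm.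
have P0 : interp_poly u A B' = 0.
  apply: (@roots_geq_poly_eq0 _ _
    (0 :: [seq (a i)^-1 | i <- enum A] ++ [seq b j | j <- enum B'])).
  - rewrite /= all_cat interp_poly_root0 /=; last exact: IH.
    apply/andP; split; apply/allP => _ /mapP[f fA ->]; rewrite mem_enum in fA.
      by rewrite -(setD1K fA) interp_poly_root_a ?setD11 // IH.
    by rewrite -(setD1K fA) interp_poly_root_b ?setD11.
  - rewrite /= mem_cat negb_or cat_uniq !map_inj_uniq ?enum_uniq ?andbT //=; last first.
      by move=> i j /invr_inj /a_inj.
    apply/andP; split; first (apply/andP; split).
    + by apply/mapP => -[i _] /esym/eqP; rewrite invr_eq0 (negPf (a_neq0 i)).
    + by apply/mapP => -[j _] /esym/eqP; rewrite (negPf (b_neq0 j)).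
    apply/hasPn => _ /mapP[j _ ->]; apply/mapP => -[i _ E].
    by have := ab_neq1 i j; rewrite E divff ?eqxx // a_neq0.
  rewrite /= size_cat !size_map -!cardE; apply: size_interp_poly => I J JB JI.
  by rewrite IH ?col_sum_eq0 // (leq_trans _ Bm) // ltnS subset_leq_card.
have := interp_poly_eval u A eB'; rewrite P0 horner0 => /esym/eqP.
rewrite !mulf_eq0 subr_eq0 => /orP[/orP[]|/eqP//] /prodf_eq0[i iA].
  by rewrite subr_eq0 (inj_eq b_inj) => /eqP ei; move: eB'; rewrite ei iA.
by rewrite (negPf (sub1ab_neq0 _ _)).
Qed.

Lemma kernel1_eq0 A B : (#|B| < #|A|)%N -> kernel 1 A B = 0.
Proof. by move=> BA; rewrite kernel_col_sum col_sum_eq0. Qed.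

End Kernel.

(** * Hall-Littlewood sums over ordered subsets of the variables *)

(** A permutation is determined by its value i at 0 and the permutation s induced on the rest;
    injectivity and a count of (n + 1)! elements give the bijection. *)
Lemma sum_lift_perm (R : nmodType) n (f : 'S_n.+1 -> R) :
  \sum_(w : 'S_n.+1) f w = \sum_(i < n.+1) \sum_(s : 'S_n) f (lift_perm ord0 i s).
Proof.
rewrite pair_bigA /=; apply: reindex; apply: onW_bij.
apply: inj_card_bij => [[i s] [i' s'] /= E|]; last first.
  by rewrite card_prod card_ord !card_Sn factS.
have ii : i = i'.
  by have := congr1 (fun w : 'S_n.+1 => w ord0) E; rewrite /= !lift_perm_id.
rewrite -ii in E *; congr (_, _); apply/permP => k; apply: (@lift_inj _ i).
by rewrite -!(lift_perm_lift ord0) E.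
Qed.

Section HLset.
Variables (F : fieldType) (t : F) (T : finType) (x : T -> F).
Implicit Types (A I : {set T}) (la mu : seq nat).

(* v_la(t) P_la(x_A; t) when [la] is a partition with #|A| parts, zeros included. *)
Fixpoint hlsym la A : F :=
  if la is a :: la' then
    \sum_(i in A) x i ^+ a * cross t x [set i] (A :\ i) * hlsym la' (A :\ i)
  else 1.

Lemma hlsym_perm n (g : 'I_n -> T) la : injective g -> size la = n ->
  \sum_(w : 'S_n) (\prod_(i < n) x (g (w i)) ^+ nth 0%N la i) *
    \prod_(i < n) \prod_(j < n | (i < j)%N)
      ((x (g (w i)) - t * x (g (w j))) / (x (g (w i)) - x (g (w j)))) =
  hlsym la (g @: setT).
Proof.
elim: n g la => [|n IH] g [|a la] //= g_inj.
  move=> _; rewrite (big_pred1 1%g) => [|w]; first by rewrite !big_ord0 mulr1.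
  by apply/esym/eqP/permP => -[].
move=> [sz]; rewrite sum_lift_perm big_imset /=; last by move=> i j _ _ /g_inj.
apply: eq_big => [i|i _]; first by rewrite inE.
have gl_inj : injective (g \o lift i) by move=> j k /g_inj /lift_inj.
have gD : (g @: setT) :\ g i = (g \o lift i) @: setT.
  apply/setP => z; rewrite !inE; apply/andP/imsetP => [[zi /imsetP[j _ zj]]|[j _ ->]].
    subst z; case: (unliftP i j) zi => [k ->|->]; last by rewrite eqxx.
    by exists k.
  by rewrite /= (inj_eq g_inj) eq_sym neq_lift; split; last exact: imset_f.
rewrite gD -(IH _ _ gl_inj sz) mulr_sumr; apply: eq_bigr => s _.
rewrite big_ord_recl lift_perm_id /= [X in _ * X = _]big_ord_recl /=.
rewrite [X in _ * (X * _)]big_mkcond big_ord_recl /= mul1r.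
have -> : cross t x [set g i] ((g \o lift i) @: setT) =
   \prod_(j < n) ((x (g i) - t * x (g (lift i (s j)))) /
                  (x (g i) - x (g (lift i (s j))))).
  rewrite /cross big_set1 big_imset /=; last by move=> j k _ _ /gl_inj.
  by rewrite (reindex_inj (@perm_inj _ s)) /=; apply: eq_bigl => j; rewrite in_setT.
rewrite -!mulrA; congr (_ * _); rewrite mulrCA; congr (_ * (_ * _)).
- by apply: eq_bigr => j _; rewrite lift_perm_lift lift_perm_id.
- by apply: eq_bigr => j _; rewrite lift_perm_lift.
apply: eq_bigr => j _; rewrite big_mkcond big_ord_recl /= mul1r [RHS]big_mkcond.
by apply: eq_bigr => k _; rewrite !lift_perm_lift.
Qed.

(** I is the set of variables that receive the exponents from [la]; the factors linking them to the
    remaining variables form [cross]. *)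
Lemma hlsym_cat la mu A :
  hlsym (la ++ mu) A = \sum_(I : {set T} | I \subset A) (#|I| == size la)%:R *
    (cross t x I (A :\: I) * hlsym la I * hlsym mu (A :\: I)).
Proof.
elim: la A => [|a la IH] A /=.
  rewrite (bigD1 set0) ?sub0set //= cards0 eqxx setD0 cross0l !mul1r.
  rewrite big1 ?addr0 // => I /andP[_ I0].
  by rewrite cards_eq0 (negPf I0) mul0r.
under eq_bigr do rewrite IH mulr_sumr.
under [RHS]eq_bigr do rewrite mulr_sumr mulr_suml mulr_sumr.
rewrite [RHS](exchange_big_dep (mem A)) /=; last first.
  by move=> I i /subsetP IA iI; apply: IA.
apply: eq_bigr => i iA.
have [A' iA' ->] : exists2 A' : {set T}, i \notin A' & A = i |: A'.
  by exists (A :\ i); rewrite ?setD11 ?setD1K.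
rewrite setU1K // big_mkcondr big_subsetU1 //; apply: eq_bigr => I IA.
have iI := notin_subset iA' IA; rewrite (negPf iI) add0r setU11.
rewrite cardsU1 iI add1n eqSS setDU11 // setU1K // crossU1l // /cross !big_set1.
rewrite (big_setDK _ IA); ring.
Qed.

Lemma hlsym_mapS mu A : size mu = #|A| ->
  hlsym (map S mu) A = \prod_(i in A) x i * hlsym mu A.
Proof.
elim: mu A => [|a mu IH] A /=.
  by move/esym/eqP; rewrite cards_eq0 => /eqP->; rewrite big_set0 mulr1.
move=> sz; rewrite mulr_sumr; apply: eq_bigr => i iA.
rewrite IH; last by apply/eqP; rewrite -eqSS sz (cardsD1 i A) iA.
have -> : \prod_(j in A) x j = x i * \prod_(j in A :\ i) x j.
  by rewrite -{1}(setD1K iA) big_setU1 ?setD11.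
by rewrite exprS; ring.
Qed.

Hypothesis x_inj : injective x.
Hypothesis x_neq0 : forall i, x i != 0.

(** This is v_k(t). The variable carrying the last zero runs over the complements of the (k -
    1)-subsets, and [cross_sum_card1] evaluates the resulting sum. *)
Lemma hlsym_nseq0 k A : #|A| = k ->
  hlsym (nseq k 0%N) A = \prod_(i < k) \sum_(j < i.+1) t ^+ j.
Proof.
elim: k A => [|k IH] A Ak; first by rewrite big_ord0.
have -> : nseq k.+1 0%N = nseq k 0%N ++ [:: 0%N] by rewrite -addn1 nseqD.
have cs := cross_sum_card1 t x_inj x_neq0 A; rewrite Ak in cs.
rewrite big_ord_recr hlsym_cat [X in _ = _ * X](_ : _ = \sum_(j < k.+1) t ^+ j) // -cs.
rewrite mulr_sumr; apply: eq_bigr => I IA; rewrite size_nseq.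
have cI := cardsDK IA; rewrite Ak -addn1 in cI.
have [Ik|Ik] := eqVneq #|I| k; last first.
  rewrite !mul0r; case: eqVneq => [D1|]; rewrite ?mul0r ?mulr0 //.
  by move/eqP: cI; rewrite D1 eqn_add2r (negPf Ik).
have /eqP := cI; rewrite Ik eqn_add2l => /[dup] D1 /cards1P[i Di].
rewrite D1 IH // !mul1r Di /= big_set1 setDv cross0r !mulr1 [RHS]mulrC.
by [].
Qed.

End HLset.

(** * The sum over partitions *)

Section Partitions.
Implicit Types (la mu : seq nat).

Definition add_column k mu : seq nat := map S mu ++ nseq k 0%N.

(** [HLnorm t] and [weight t] are the cases f = [vfact t] and f = [qfact t]. *)
Definition multprod (R : comPzRingType) (f : nat -> R) la : R :=
  \prod_(i <- undup la) f (count_mem i la).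

Lemma multprodE (R : comPzRingType) (f : nat -> R) N la : f 0%N = 1 ->
  all (fun i => i < N)%N la -> multprod f la = \prod_(i < N) f (count_mem (i : nat) la).
Proof.
move=> f0 /allP laN; rewrite -(big_mkord predT (fun i => f (count_mem i la))).
rewrite (bigID (mem la)) /= [X in _ * X]big1 ?mulr1; last first.
  by move=> i /count_memPn->.
rewrite -big_filter; apply: perm_big; apply: uniq_perm; rewrite ?undup_uniq //.
  by rewrite filter_uniq // iota_uniq.
move=> i; rewrite mem_undup mem_filter mem_index_iota.
by case: (boolP (i \in la)) => // /laN ->.
Qed.

Lemma multprod_add_column (R : comPzRingType) (f : nat -> R) k mu : f 0%N = 1 ->
  multprod f (add_column k mu) = multprod f mu * f k.
Proof.
move=> f0; pose N := (\max_(i <- mu) i).+1.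
have muN : all (fun i => i < N)%N mu.
  by apply/allP => i imu; rewrite ltnS (@leq_bigmax_seq _ mu predT (fun i => i)).
rewrite (multprodE f0 muN) (multprodE (N := N.+1) f0); last first.
  rewrite all_cat all_map /= (sub_all _ muN) //=.
  by apply/allP => i /nseqP[->].
rewrite big_ord_recl mulrC; congr (_ * _).
  apply: eq_bigr => i _; rewrite count_cat count_map count_nseq /= addn0.
  by congr (f _); apply: eq_count => j /=; rewrite eqSS.
rewrite count_cat count_map count_nseq /= mul1n; congr f.
by rewrite (eq_count (a2 := pred0)) ?count_pred0.
Qed.

(** Partitions are enumerated by the number r of positive parts and what remains after deleting the
    first column, so that the recursion for the sum can be read off. *)
Fixpoint parts d n : seq (seq nat) :=
  if d is d'.+1 then
    [seq add_column (n - r) mu | r <- iota 0 n.+1, mu <- parts d' r]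
  else [:: nseq n 0%N].

Lemma sorted_add_column la : sorted geq la ->
  exists2 mu, sorted geq mu & exists k, la = add_column k mu.
Proof.
elim: la => [|a la IH] /=; first by exists [::] => //; exists 0%N.
case: a => [|a] pla.
  exists [::] => //; exists (size la).+1; congr (_ :: _).
  apply/all_pred1P; move: pla; rewrite (path_sortedE (rev_trans leq_trans)).
  by case/andP => h _; apply: sub_all h => i; rewrite /= leqn0.
have [mu smu [k Dla]] := IH (path_sorted pla).
exists (a :: mu); last by exists k; rewrite Dla.
case: mu smu Dla pla => //= b mu smu -> /andP[ab _].
by rewrite smu andbT.
Qed.

Lemma size_add_column k mu : size (add_column k mu) = (size mu + k)%N.
Proof. by rewrite size_cat size_map size_nseq. Qed.

Lemma mem_parts d n la :
  (la \in parts d n) = [&& size la == n, sorted geq la & all (fun i => i <= d)%N la].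
Proof.
elim: d n la => [|d IH] n la.
  rewrite inE; apply/eqP/and3P => [->|[/eqP <- _ h]].
    rewrite size_nseq eqxx; split=> //; last by apply/allP => i /nseqP[->].
    by elim: n => [|[|n] h].
  by apply/all_pred1P; apply: sub_all h => i; rewrite leqn0.
apply/allpairsPdep/and3P => [[r [mu []]]|[/eqP sz /sorted_add_column[mu smu [k Dla]] h]].
  rewrite mem_iota ltnS IH => rn /and3P[/eqP sz smu ha] ->; split.
  - by rewrite size_add_column sz subnKC.
  - have z a k : path geq a (nseq k 0%N) by elim: k a => //= k h a; rewrite h.
    case: mu smu {sz ha} => [_|a mu /= smu]; first by case: (n - r)%N => //=.
    rewrite cat_path z andbT path_map; apply: sub_path smu => i j; exact.
  rewrite all_cat all_map; apply/andP; split; last by apply/allP => i /nseqP[->].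
  by apply: sub_all ha => i.
exists (size mu), mu; move: sz h; rewrite Dla size_add_column => <-.
rewrite mem_iota /= ltnS leq_addr addKn; split => //.
rewrite IH eqxx smu; move: h; rewrite all_cat all_map => /andP[h _].
by apply: sub_all h => i.
Qed.

Lemma uniq_parts d n : uniq (parts d n).
Proof.
elim: d n => // d IH n; apply: allpairs_uniq_dep; first exact: iota_uniq.
  by move=> r _; exact: IH.
move=> _ _ /allpairsPdep[r [mu [_ hmu ->]]] /allpairsPdep[r' [mu' [_ hmu' ->]]] /= E.
(* Dropping the zeros and lowering the other entries undoes [add_column], whatever k is. *)
have filt k nu : map predn (filter (fun i => 0 < i)%N (add_column k nu)) = nu.
  rewrite filter_cat (_ : filter _ (nseq k 0%N) = [::]); last first.
    by elim: k.
  by rewrite cats0 filter_map /= filter_predT -map_comp map_id.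
have mm : mu = mu' by rewrite -(filt (n - r)%N mu) E filt.
move: hmu hmu'; rewrite !mem_parts => /andP[/eqP <- _] /andP[/eqP <- _].
by rewrite mm.
Qed.

Lemma sum_parts (R : nmodType) (f : seq nat -> R) d n :
  \sum_(l : n.-tuple 'I_d.+1 | sorted geq (map_tuple val l)) f (map_tuple val l) =
  \sum_(la <- parts d n) f la.
Proof.
rewrite -(big_map (fun l : n.-tuple 'I_d.+1 => map val l)
  (fun la => sorted geq la) f) -big_filter.
apply: perm_big; apply: uniq_perm; rewrite ?uniq_parts //.
  rewrite filter_uniq // map_inj_uniq ?index_enum_uniq // => l l' /(inj_map val_inj) E.
  exact: val_inj.
move=> la; rewrite mem_filter mem_parts andbCA; congr (_ && _).
apply/mapP/andP => [[l _ ->]|[/eqP sz h]].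
  rewrite size_map size_tuple; split => //; apply/allP => _ /mapP[i _ ->].
  by rewrite -ltnS ltn_ord.
have szl : size (map (@inord d) la) == n by rewrite size_map sz.
exists (Tuple szl); rewrite ?mem_index_enum //= -map_comp -[LHS]map_id.
by apply/eq_in_map => i ila /=; rewrite inordK // ltnS (allP h).
Qed.

End Partitions.

Lemma cross_rmorph (F M : fieldType) (f : {rmorphism F -> M}) t (T : finType)
    (x : T -> F) I J : cross (f t) (f \o x) I J = f (cross t x I J).
Proof.
rewrite /cross rmorph_prod; apply: eq_bigr => i _; rewrite rmorph_prod.
by apply: eq_bigr => j _; rewrite fmorph_div !rmorphB rmorphM.
Qed.

Lemma cross_scale (F : fieldType) (t c : F) (T : finType) (x : T -> F) I J :
  c != 0 -> cross t (fun i => c * x i) I J = cross t x I J.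
Proof.
move=> c0; apply: eq_bigr => i _; apply: eq_bigr => j _.
by rewrite mulrCA -!mulrBr -mulf_div divff // mul1r.
Qed.

Lemma qcoef_rmorph (F M : fieldType) (f : {rmorphism F -> M}) t u l :
  qcoef (f t) (f u) l = f (qcoef t u l).
Proof. by rewrite /qcoef rmorphM !rmorphXn rmorphN. Qed.

Lemma qpoch_rmorph (F M : fieldType) (f : {rmorphism F -> M}) t u l :
  qpoch (f t) (f u) l = f (qpoch t u l).
Proof.
rewrite /qpoch rmorph_prod; apply: eq_bigr => i _.
by rewrite rmorphB rmorph1 rmorphM rmorphXn.
Qed.

Definition qfact (F : fieldType) (t : F) k : F := \prod_(1 <= j < k.+1) (1 - t ^+ j).
Definition vfact (F : fieldType) (t : F) k : F :=
  \prod_(1 <= j < k.+1) ((1 - t ^+ j) / (1 - t)).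

Lemma qfactE (F : fieldType) (t : F) k : qfact t k = qpoch t t k.
Proof.
by rewrite /qfact big_add1 big_mkord; apply: eq_bigr => i _; rewrite -exprS.
Qed.

Lemma vfactE (F : fieldType) (t : F) k : 1 - t != 0 ->
  vfact t k = \prod_(i < k) \sum_(j < i.+1) t ^+ j.
Proof.
move=> t1; rewrite /vfact big_add1 big_mkord; apply: eq_bigr => i _.
by rewrite -[1 - t ^+ _]opprB subrX1 -mulNr opprB mulrC mulKf.
Qed.

(** * The truncated generating polynomial modulo powers of the degree marker *)

Section Generating.
Variables (L : fieldType) (t : L) (S T : finType) (y : S -> L) (x : T -> L).
Implicit Types (A I K : {set S}) (B J : {set T}).

(** w_la / v_la^2: each [hlsym] is v_la times a Hall-Littlewood polynomial, once in x and once in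
    y. *)
Definition norm_coef la : L := multprod (qfact t) la / multprod (vfact t) la ^+ 2.

(* The parts are smaller than [d], and 'X marks the degree in [x]. *)
Definition hl_gen d A B : {poly L} :=
  if d is d'.+1 then
    \sum_(la <- parts d' #|A|)
      (norm_coef la * (hlsym t y la A * hlsym t x la B)) *: 'X^(sumn la)
  else (#|A| == 0%N)%:R.

Definition kernel_num A B : {poly L} :=
  \sum_(K : {set S} | K \subset A)
    (qcoef t t #|A :\: K| * cross t y K (A :\: K)) *:
    \prod_(i in A) \prod_(j in B) lin 1 (- ((if i \in K then t else 1) * y i * x j)).

Definition kernel_den A B : {poly L} :=
  \prod_(i in A) \prod_(j in B) lin 1 (- (y i * x j)).

(** The quotient of [kernel_den A B] by [kernel_den I J] for subsets I and J, written without
    division. *)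
Definition kernel_codiv A B I J : {poly L} :=
  kernel_den (A :\: I) B * kernel_den I (B :\: J).

Lemma kernel_codivK A B I J : I \subset A -> J \subset B ->
  kernel_codiv A B I J * kernel_den I J = kernel_den A B.
Proof.
move=> IA JB; rewrite /kernel_codiv -mulrA -big_split /= /kernel_den (big_setDK _ IA).
by congr (_ * _); apply: eq_bigr => i _; rewrite (big_setDK _ JB).
Qed.

Definition rec_coef A B I J : L :=
  (#|J| == #|I|)%:R *
  (qpoch t t #|A :\: I| * cross t y I (A :\: I) * cross t x J (B :\: J) *
   \prod_(i in I) y i * \prod_(j in J) x j).

Hypothesis y_inj : injective y.
Hypothesis y_neq0 : forall i, y i != 0.
Hypothesis x_inj : injective x.
Hypothesis x_neq0 : forall j, x j != 0.

Lemma lin1_neq0 (b : L) : lin 1 b != 0.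
Proof.
apply/eqP => /(congr1 (fun p : {poly L} => p.[0])); rewrite horner_lin horner0.
by rewrite mulr0 addr0 => /eqP; rewrite oner_eq0.
Qed.

(** This is [kernel_col_sum] for a_i = y_i and b_j = X x_j in the fraction field of L[X], with
    denominators cleared. There a_i b_j = 1 is impossible, [cross] ignores the scaling by X, and the
    product of the b_j over J yields ['X^#|I|]. *)
Lemma kernel_num_rec A B : kernel_num A B =
  \sum_(I : {set S} | I \subset A) \sum_(J : {set T} | J \subset B)
    rec_coef A B I J *: ('X^#|I| * kernel_codiv A B I J * kernel_num I J).
Proof.
have [M [h h_inj]] : exists (M : fieldType) (h : {rmorphism {poly L} -> M}), injective h.
  exists {fraction {poly L}}, (@tofrac {poly L}) => p q /eqP.
  by rewrite tofrac_eq => /eqP.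
have h_eq0 p : (h p == 0) = (p == 0) by rewrite -(inj_eq h_inj) rmorph0.
pose f : {rmorphism L -> M} := h \o polyC.
have fE c : h c%:P = f c by [].
pose z : M := h 'X.
have z0 : z != 0 by rewrite h_eq0 polyX_eq0.
pose a i := f (y i); pose b j := z * f (x j).
have a_inj : injective a by move=> i j /fmorph_inj /y_inj.
have a_neq0 i : a i != 0 by rewrite fmorph_eq0.
have b_inj : injective b by move=> i j /(mulfI z0) /fmorph_inj /x_inj.
have b_neq0 j : b j != 0 by rewrite mulf_eq0 negb_or z0 fmorph_eq0 x_neq0.
have lE c i j : 1 - f c * a i * b j = h (lin 1 (- (c * y i * x j))).
  rewrite /lin rmorphD rmorph1 scaleNr rmorphN; congr (_ - _).
  by rewrite -mul_polyC rmorphM /= !polyCM !rmorphM /a /b /f /z /=; ring.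
have l1E i j : 1 - a i * b j = h (lin 1 (- (y i * x j))).
  by have := lE 1 i j; rewrite rmorph1 !mul1r.
have ab_neq1 i j : a i * b j != 1.
  by rewrite eq_sym -subr_eq0 l1E h_eq0 lin1_neq0.
have denE A0 B0 : h (kernel_den A0 B0) =
    \prod_(i in A0) \prod_(j in B0) (1 - a i * b j).
  rewrite rmorph_prod; apply: eq_bigr => i _; rewrite rmorph_prod.
  by apply: eq_bigr => j _; rewrite l1E.
have numE A0 B0 : h (kernel_num A0 B0) =
    h (kernel_den A0 B0) * kernel (f t) a b (f t) A0 B0.
  rewrite denE rmorph_sum mulr_sumr; apply: eq_bigr => K KA.
  rewrite -mul_polyC (rmorphM h) fE rmorphM.
  rewrite -qcoef_rmorph -cross_rmorph mulrCA; congr (_ * _).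
  rewrite (big_setDK _ KA) (big_setDK _ KA) -mulrA rmorphM; congr (_ * _).
    rewrite rmorph_prod; apply: eq_bigr => i; rewrite inE => /andP[iK _].
    rewrite rmorph_prod; apply: eq_bigr => j _.
    by rewrite (negPf iK) mul1r l1E.
  rewrite /pairing -big_split rmorph_prod; apply: eq_bigr => i iK /=.
  rewrite -big_split rmorph_prod; apply: eq_bigr => j _ /=.
  by rewrite iK -lE [RHS]mulrC divfK // subr_eq0 eq_sym.
apply: h_inj; rewrite numE (kernel_col_sum (f t) a_inj a_neq0 b_inj b_neq0 ab_neq1).
rewrite mulr_sumr rmorph_sum; apply: eq_bigr => I IA.
rewrite mulr_sumr rmorph_sum; apply: eq_bigr => J JB.
rewrite -mul_polyC (rmorphM h) fE !(rmorphM h) numE -(kernel_codivK IA JB) (rmorphM h).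
have hb : \prod_(j in J) b j = z ^+ #|J| * f (\prod_(j in J) x j).
  by rewrite big_split prodr_const rmorph_prod.
have cb : cross (f t) b J (B :\: J) = f (cross t x J (B :\: J)).
  by rewrite -cross_rmorph; exact: cross_scale.
have ha : \prod_(i in I) a i = f (\prod_(i in I) y i) by rewrite rmorph_prod.
have ca : cross (f t) a I (A :\: I) = f (cross t y I (A :\: I)).
  exact: cross_rmorph.
rewrite hb cb ha ca qpoch_rmorph /rec_coef !(rmorphM f) rmorph_nat (rmorphXn h) -/z.
have [JI|] := eqVneq #|J| #|I|; last by rewrite !mul0r mulr0.
rewrite JI /kernel_codiv (rmorphM h); ring.
Qed.

Lemma parts0 d : parts d 0 = [:: [::]].
Proof. by elim: d => //= d ->. Qed.

Lemma multprod_nil (f : nat -> L) : multprod f [::] = 1.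
Proof. by rewrite /multprod big_nil. Qed.

Lemma hl_gen_set0 d : hl_gen d set0 set0 = 1.
Proof.
case: d => [|d] /=; rewrite cards0 //.
by rewrite parts0 big_seq1 /norm_coef !multprod_nil expr1n divr1 !mulr1 scale1r.
Qed.

Lemma kernel_num_set0 : kernel_num set0 set0 = 1.
Proof.
rewrite /kernel_num (big_pred1 set0) => [|K]; last by rewrite subset0.
by rewrite set0D cards0 cross0l big_set0 /qcoef bin0n expr0 !mulr1 scale1r.
Qed.

Hypothesis t_gen : forall k, (0 < k)%N -> 1 - t ^+ k != 0.

Lemma vfact_neq0 k : vfact t k != 0.
Proof.
rewrite /vfact big_add1 big_mkord; apply/prodf_neq0 => i _.
by rewrite mulf_neq0 ?t_gen // invr_eq0 -[t]expr1 t_gen.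
Qed.

(** The k zeros contribute [vfact t k] to [hlsym] in x and again in y; both cancel against the
    squared normalization and leave (t; t)_k. *)
Lemma norm_coef_add_column k mu :
  norm_coef (add_column k mu) * vfact t k ^+ 2 = norm_coef mu * qfact t k.
Proof.
rewrite /norm_coef !multprod_add_column; try by rewrite /qfact /vfact big_geq.
rewrite exprMn invfM; set v := vfact t k ^+ 2; set w := multprod _ mu ^+ 2.
have vv : v^-1 * v = 1 by rewrite mulVf // expf_neq0 // vfact_neq0.
transitivity (multprod (qfact t) mu * qfact t k * w^-1 * (v^-1 * v)); first by ring.
by rewrite vv; ring.
Qed.

Lemma hlsym_add_column (U : finType) (u : U -> L) (A : {set U}) k mu :
  injective u -> (forall i, u i != 0) -> (size mu + k)%N = #|A| ->
  hlsym t u (add_column k mu) A =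
  \sum_(I : {set U} | I \subset A) (#|I| == size mu)%:R *
    (cross t u I (A :\: I) * (\prod_(i in I) u i * hlsym t u mu I)) * vfact t k.
Proof.
move=> u_inj u0 sz; rewrite hlsym_cat size_map; apply: eq_bigr => I IA.
have [cI|] := eqVneq #|I| (size mu); last by rewrite !mul0r.
rewrite !mul1r hlsym_mapS // hlsym_nseq0 // -?vfactE //; first by rewrite -[t]expr1 t_gen.
by apply/eqP; rewrite -(eqn_add2l #|I|) cardsDK // -sz cI.
Qed.

Lemma hl_gen_term A B r mu : #|A| = #|B| -> (r <= #|A|)%N -> size mu = r ->
  (norm_coef (add_column (#|A| - r) mu) *
    (hlsym t y (add_column (#|A| - r) mu) A * hlsym t x (add_column (#|A| - r) mu) B)) *:
    'X^(sumn (add_column (#|A| - r) mu)) =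
  \sum_(I : {set S} | I \subset A) \sum_(J : {set T} | J \subset B)
    ((#|I| == r)%:R * rec_coef A B I J) *: ('X^#|I| *
      ((norm_coef mu * (hlsym t y mu I * hlsym t x mu J)) *: 'X^(sumn mu))).
Proof.
move=> AB rA sz.
rewrite (hlsym_add_column y_inj y_neq0) ?sz ?subnKC //.
rewrite (hlsym_add_column x_inj x_neq0) ?sz ?subnKC -?AB //.
rewrite -!mulr_suml.
have reorder (c v p q : L) : c * (p * v * (q * v)) = c * v ^+ 2 * (p * q) by ring.
rewrite reorder norm_coef_add_column mulr_suml mulr_sumr scaler_suml.
apply: eq_bigr => I IA; rewrite mulr_sumr mulr_sumr scaler_suml; apply: eq_bigr => J JB.
rewrite -scalerAr scalerA -exprD /rec_coef.
have [cI|] := eqVneq #|I| r; last by rewrite !mul0r mulr0 !scale0r.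
rewrite cI; have -> : (#|A| - r)%N = #|A :\: I| by rewrite -(cardsDK IA) cI addKn.
have -> : sumn (add_column #|A :\: I| mu) = (r + sumn mu)%N.
  rewrite sumn_cat sumn_nseq mul0n addn0 -sz.
  by elim: (mu) => //= a s ->; rewrite !addSn addnCA.
rewrite qfactE; congr (_ *: _); ring.
Qed.

Lemma hl_gen_rec d A B : #|A| = #|B| -> hl_gen d.+1 A B =
  \sum_(I : {set S} | I \subset A) \sum_(J : {set T} | J \subset B)
    rec_coef A B I J *: ('X^#|I| * hl_gen d I J).
Proof.
move=> AB; case: d => [|d].
  (* With all parts zero, only r = 0 and the empty [mu] remain; this matches [hl_gen 0], which
     vanishes unless I is empty. *)
  have := @hl_gen_term A B 0 [::] AB (leq0n _) erefl; rewrite subn0 => E.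
  rewrite [LHS]/= big_seq1; etransitivity; first exact: E.
  apply: eq_bigr => I _; apply: eq_bigr => J _.
  rewrite /norm_coef !multprod_nil expr1n divr1 !mulr1 scale1r /=.
  by case: eqP => _; rewrite ?mul1r // mul0r !mulr0 scale0r scaler0.
pose term I J r mu : {poly L} := ((#|I| == r)%:R * rec_coef A B I J) *:
  ('X^#|I| * ((norm_coef mu * (hlsym t y mu I * hlsym t x mu J)) *: 'X^(sumn mu))).
transitivity (\sum_(r <- iota 0 #|A|.+1) \sum_(mu <- parts d r)
    \sum_(I : {set S} | I \subset A) \sum_(J : {set T} | J \subset B) term I J r mu).
  rewrite -[LHS]/(\sum_(la <- [seq add_column (#|A| - r) mu | r <- iota 0 #|A|.+1,
    mu <- parts d r]) _) big_allpairs_dep.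
  apply: eq_big_seq => r; rewrite mem_iota ltnS => rA.
  apply: eq_big_seq => mu; rewrite mem_parts => /andP[/eqP sz _].
  exact: hl_gen_term.
under eq_bigr do rewrite exchange_big.
rewrite exchange_big; apply: eq_bigr => I IA.
under eq_bigr do rewrite exchange_big.
rewrite exchange_big; apply: eq_bigr => J JB.
rewrite (bigD1_seq #|I|) ?iota_uniq ?mem_iota ?ltnS ?subset_leq_card //=.
rewrite [X in _ + X]big1 => [|r rI]; last first.
  by rewrite big1 // => mu _; rewrite /term eq_sym (negPf rI) mul0r scale0r.
rewrite addr0 mulr_sumr scaler_sumr; apply: eq_bigr => mu _.
by rewrite /term eqxx mul1r.
Qed.

Lemma dvdp_bigsum (I : Type) (r : seq I) (P : pred I) (f : I -> {poly L}) q :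
  (forall i, P i -> q %| f i) -> q %| \sum_(i <- r | P i) f i.
Proof.
move=> qf; elim/big_rec: _ => [|i p Pi qp]; first exact: dvdp0.
by rewrite dvdp_add ?qf.
Qed.

(** In the recursion the term of a nonempty I carries ['X^#|I|] and gains at least one power of X
    over the induction hypothesis; for empty I the two sides agree exactly. *)
Theorem hl_gen_congr d A B : #|A| = #|B| ->
  'X^d %| kernel_den A B * hl_gen d A B - kernel_num A B.
Proof.
elim: d A B => [|d IH] A B AB; first by rewrite expr0 dvd1p.
rewrite hl_gen_rec // kernel_num_rec mulr_sumr -sumrB.
apply: dvdp_bigsum => I IA.
rewrite mulr_sumr -sumrB.
apply: dvdp_bigsum => J JB.
have [JI|JI] := eqVneq #|J| #|I|; last first.
  by rewrite /rec_coef (negPf JI) mul0r !scale0r mulr0 subrr dvdp0.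
rewrite -scalerAr -scalerBr -(kernel_codivK IA JB).
have [/eqP I0|I0] := posnP #|I|.
  have J0 : J = set0 by apply/eqP; rewrite -cards_eq0 JI.
  move: I0; rewrite cards_eq0 => /eqP I0; rewrite I0 J0 hl_gen_set0 kernel_num_set0.
  have -> : kernel_den set0 set0 = 1 by rewrite /kernel_den big_set0.
  rewrite cards0 expr0 !mulr1 mul1r subrr scaler0.
  exact: dvdp0.
rewrite -mul_polyC; apply: dvdp_mull.
have -> : kernel_codiv A B I J * kernel_den I J * ('X^#|I| * hl_gen d I J) -
    'X^#|I| * kernel_codiv A B I J * kernel_num I J = 'X^#|I| *
    (kernel_den I J * hl_gen d I J - kernel_num I J) * kernel_codiv A B I J by ring.
apply: dvdp_mulr; apply: dvdp_trans (dvdp_mul (dvdpp _) (IH _ _ (esym JI))).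
by rewrite -exprD dvdp_exp2l // -add1n leq_add2r.
Qed.

End Generating.

Lemma hlsym_rmorph (F M : fieldType) (f : {rmorphism F -> M}) t (T : finType)
    (x : T -> F) la A : hlsym (f t) (f \o x) la A = f (hlsym t x la A).
Proof.
elim: la A => [|a la IH] A /=; first by rewrite rmorph1.
rewrite rmorph_sum; apply: eq_bigr => i _.
by rewrite !rmorphM rmorphXn IH cross_rmorph.
Qed.

Lemma multprod_rmorph (F M : fieldType) (f : {rmorphism F -> M}) g la :
  multprod (f \o g) la = f (multprod g la).
Proof. by rewrite /multprod rmorph_prod. Qed.

Lemma vfact_rmorph (F M : fieldType) (f : {rmorphism F -> M}) t k :
  vfact (f t) k = f (vfact t k).
Proof.
rewrite /vfact rmorph_prod; apply: eq_bigr => i _.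
by rewrite fmorph_div !rmorphB rmorph1 rmorphXn.
Qed.

Lemma qfact_rmorph (F M : fieldType) (f : {rmorphism F -> M}) t k :
  qfact (f t) k = f (qfact t k).
Proof.
rewrite /qfact rmorph_prod; apply: eq_bigr => i _.
by rewrite rmorphB rmorph1 rmorphXn.
Qed.

Lemma norm_coef_rmorph (F M : fieldType) (f : {rmorphism F -> M}) t la :
  norm_coef (f t) la = f (norm_coef t la).
Proof.
rewrite /norm_coef fmorph_div rmorphXn -!multprod_rmorph.
congr (_ / _ ^+ 2); apply: eq_bigr => i _; [exact: qfact_rmorph|exact: vfact_rmorph].
Qed.

(** * Symmetry and evaluation of the Hall-Littlewood polynomials *)

Section HLpoly.
Variables (K : fieldType) (t : K) (n : nat).
Let Xp (i : 'I_n) : {mpoly K[n]} := 'X_i.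

Lemma HLvdm (la : n.-tuple nat) : HL t la * vdm Xp =
  (HLnorm t la)^-1 *: \sum_(w : 'S_n) (-1) ^+ w * msym w (HLnum t la).
Proof. by apply/eqP; rewrite -tofrac_eq rmorphM /= HLE HLfracE. Qed.

Lemma msym_HL (la : n.-tuple nat) s : msym s (HL t la) = HL t la.
Proof.
have vs : msym s (vdm Xp) = (-1) ^+ s * vdm Xp.
  rewrite -vdm_perm /vdm rmorph_prod; apply: eq_bigr => i _.
  rewrite rmorph_prod; apply: eq_bigr => j _ /=.
  by rewrite rmorphB /= !msymXU.
apply: (mulIf (vdmX_neq0 K n)); rewrite HLvdm.
have := congr1 (msym s) (HLvdm la); rewrite msymM vs msymZ.
rewrite (rmorph_sum (msym s)) => /(congr1 ( *%R ((-1) ^+ s))).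
rewrite mulrCA signrMK => ->.
rewrite -scalerAr; congr (_ *: _); rewrite mulr_sumr.
rewrite [RHS](reindex_inj (mulIg s)) /=; apply: eq_bigr => w _.
rewrite odd_permM signr_addb msymM -msymMm rmorphXn rmorphN1 mulrA.
by rewrite [(-1) ^+ s * _]mulrC.
Qed.

(** At a point with distinct coordinates the Vandermonde product is nonzero and can be cancelled, so
    Macdonald's formula holds for values as well. *)
Lemma mmap_HL (M : fieldType) (h : {rmorphism K -> M}) (x : 'I_n -> M)
    (la : n.-tuple nat) : injective x ->
  mmap h x (HL t la) = (h (HLnorm t la))^-1 * hlsym (h t) x la setT.
Proof.
move=> x_inj.
have vx : mmap h x (vdm Xp) = vdm x.
  rewrite rmorph_prod; apply: eq_bigr => i _; rewrite rmorph_prod.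
  by apply: eq_bigr => j _ /=; rewrite rmorphB /= !mmapX !mmap1U.
have v0 : vdm x != 0.
  apply/prodf_neq0 => i _; apply/prodf_neq0 => j ij.
  by rewrite subr_eq0 (inj_eq x_inj); apply: contraL ij => /eqP->; rewrite ltnn.
apply: (mulIf v0); rewrite -{1}vx -rmorphM /= HLvdm mmapZ fmorphV -mulrA.
congr (_ * _).
have -> : setT = (fun i : 'I_n => i) @: setT by rewrite imset_id.
rewrite -hlsym_perm ?size_tuple // raddf_sum mulr_suml; apply: eq_bigr => w _ /=.
have -> : mmap h x ((-1) ^+ w * msym w (HLnum t la)) = (-1) ^+ w *
    (\prod_(i < n) x (w i) ^+ nth 0%N la i *
     \prod_(i < n) \prod_(j < n | (i < j)%N) (x (w i) - h t * x (w j))).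
  rewrite rmorphM rmorphXn rmorphN1 /HLnum msymM rmorphM.
  congr (_ * (_ * _)); rewrite !rmorph_prod.
    apply: eq_bigr => i _; rewrite rmorphXn /= msymXU rmorphXn /= mmapX mmap1U.
    by rewrite (tnth_nth 0%N).
  apply: eq_bigr => i _; rewrite !rmorph_prod; apply: eq_bigr => j _ /=.
  by rewrite mul_mpolyC msymB msymZ !msymXU rmorphB /= mmapZ !mmapX !mmap1U.
have -> : vdm x = (-1) ^+ w * vdm (x \o w) by rewrite vdm_perm signrMK.
rewrite [RHS]mulrCA; congr (_ * _); rewrite -mulrA; congr (_ * _).
rewrite -big_split; apply: eq_bigr => i _; rewrite -big_split; apply: eq_bigr => j ij /=.
rewrite divfK // subr_eq0 (inj_eq x_inj) (inj_eq perm_inj).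
by apply: contraL ij => /eqP->; rewrite ltnn.
Qed.

End HLpoly.

(** * Marking a weighted degree by one variable *)

Section Grading.
Variables (K : fieldType) (n : nat) (L : fieldType) (e : {rmorphism {mpoly K[n]} -> L}).
Hypothesis e_inj : injective e.
Variable a : 'I_n -> nat.

(** The variables survive inside the coefficients, through e, while ['X] records a weight. It is
    used with weight 1 throughout for the total degree, and with the indicator of the last variable
    for the degree in it. *)
Definition grade_map : {mpoly K[n]} -> {poly L} :=
  mmap (polyC \o (e \o @mpolyC n K)) (fun i => e 'X_i *: 'X^(a i)).

Definition wdeg (m : 'X_{1..n}) := (\sum_(i < n) a i * m i)%N.

Lemma grade_mapE p :
  grade_map p = \sum_(m <- msupp p) e (p@_m *: 'X_[m]) *: 'X^(wdeg m).
Proof.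
rewrite /grade_map /mmap; apply: eq_bigr => m _.
rewrite -mul_mpolyC rmorphM -scalerA -mul_polyC /=; congr (_ * _).
rewrite /mmap1 mpolyXE_id rmorph_prod.
transitivity (\prod_(i < n) ((e ('X_i ^+ m i))%:P * 'X^(a i * m i))).
  by apply: eq_bigr => i _; rewrite -mul_polyC exprMn rmorphXn polyC_exp exprM.
by rewrite big_split /= -rmorph_prod -prodrXr mul_polyC.
Qed.

(** The coefficient of ['X^d] is the image under e of the component of weight d, and e is
    injective. *)
Lemma coef_grade_map_eq0 p d m : (grade_map p)`_d = 0 -> wdeg m = d -> p@_m = 0.
Proof.
move=> h wm; have [mp|] := boolP (m \in msupp p); last first.
  by rewrite mcoeff_msupp negbK => /eqP.
have : \sum_(k <- msupp p | wdeg k == d) p@_k *: 'X_[k] = 0 :> {mpoly K[n]}.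
  apply: e_inj; rewrite rmorph0 -h grade_mapE coef_sum rmorph_sum big_mkcond.
  apply: eq_bigr => k _; rewrite coefZ coefXn eq_sym.
  by case: eqP => _; rewrite ?mulr1 ?mulr0.
move/(congr1 (mcoeff m)); rewrite mcoeff0 raddf_sum /= => <-.
rewrite big_mkcond (bigD1_seq m) ?msupp_uniq //= wm eqxx mcoeffZ mcoeffX eqxx mulr1.
rewrite big1 ?addr0 // => k km; case: ifP => // _.
by rewrite mcoeffZ mcoeffX (negPf km) mulr0.
Qed.

End Grading.

Lemma mcoeffXM (K : fieldType) n (p : {mpoly K[n]}) k m :
  ('X_[k] * p)@_m = if (k <= m)%MM then p@_(m - k)%MM else 0.
Proof.
case: ifP => km.
  by have := submK km; set j := (m - k)%MM => <-; rewrite addmC mulrC mcoeffMX.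
rewrite [p]mpolyE mulr_sumr raddf_sum /= big1 // => j _.
rewrite -scalerAr -mpolyXD mcoeffZ mcoeffX; case: eqP => [E|]; rewrite ?mulr0 //.
by rewrite -E lem_addr in km.
Qed.

(** The coefficient at m of a product sees the series only up to degree [mdeg m], so a truncation
    can replace it and products with series become products of polynomials. *)
Lemma mps_mulpE (K : fieldType) n (p q : {mpoly K[n]}) f m :
  (forall k, (mdeg k <= mdeg m)%N -> q@_k = f k) -> mps_mulp p f m = (p * q)@_m.
Proof.
move=> qf; rewrite {2}[p]mpolyE mulr_suml raddf_sum /mps_mulp big_mkcond.
apply: eq_bigr => k _ /=; rewrite -scalerAl mcoeffZ mcoeffXM.
case: ifP => km; last by rewrite mulr0.
by rewrite qf // -{2}(submK km) mdegD leq_addr.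
Qed.

(** * The numerator of F_n *)

Lemma mpoly_embedding (K : fieldType) n :
  exists (L : fieldType) (e : {rmorphism {mpoly K[n]} -> L}), injective e.
Proof.
exists {fraction {mpoly K[n]}}, (@tofrac {mpoly K[n]}) => p q /eqP.
by rewrite tofrac_eq => /eqP.
Qed.

Lemma mpolyXU_inj (K : fieldType) n : injective (fun i => 'X_i : {mpoly K[n]}).
Proof.
move=> i j /(congr1 (mcoeff U_(j))); rewrite !mcoeffXU eqxx; case: eqP => // _.
by move/esym/eqP; rewrite oner_eq0.
Qed.

Lemma mpolyXU_neq0 (K : fieldType) n i : ('X_i : {mpoly K[n]}) != 0.
Proof.
apply/eqP => /(congr1 (mcoeff U_(i))); rewrite mcoeffXU eqxx mcoeff0.
by move/eqP; rewrite oner_eq0.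
Qed.

Section NumDen.
Variables (K : fieldType) (t : K) (n : nat) (y : 'I_n -> K).

Definition Fden : {mpoly K[n]} := \prod_(i < n) \prod_(j < n) (1 - y j *: 'X_i).

Definition Fnum_coef (B : {set 'I_n}) : K := qcoef t t #|~: B| * cross t y B (~: B).

(* The coefficients involve only [y], so that \prod_(i, j) (1 - x_i y_j) F_n is
   visibly a polynomial in [x]; this is why the roles of [a] and [b] in [kernel] are
   played by [y] and [x]. *)
Definition Fnum : {mpoly K[n]} := \sum_(B : {set 'I_n})
  Fnum_coef B *:
    \prod_(i < n) \prod_(j < n) (1 - ((if i \in B then t else 1) * y i) *: 'X_j).

Hypothesis y_inj : injective y.
Hypothesis y_neq0 : forall i, y i != 0.
Hypothesis t_gen : forall k, (0 < k)%N -> 1 - t ^+ k != 0.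

(** All members of [parts d n] have size n, so the default 0 is never taken; [insub] only restores
    the tuple type. *)
Lemma Fpartial_parts d : Fpartial t y d = \sum_(la <- parts d n)
  if insub la is Some l then (weight t l * (HL t l).@[y]) *: HL t (l : n.-tuple nat) else 0.
Proof.
rewrite -(sum_parts (fun la => if insub la is Some l then
  (weight t l * (HL t l).@[y]) *: HL t (l : n.-tuple nat) else 0)).
by apply: eq_bigr => l _; rewrite valK.
Qed.

Lemma grade_map_lin (L : fieldType) (e : {rmorphism {mpoly K[n]} -> L}) a c i :
  grade_map e a (1 - c *: 'X_i) = 1 - (e c%:MP * e 'X_i) *: 'X^(a i).
Proof.
rewrite /grade_map rmorphB rmorph1 /= mmapZ mmapX mmap1U /=.
by rewrite mul_polyC scalerA.
Qed.

Lemma grade_map_homog (L : fieldType) (e : {rmorphism {mpoly K[n]} -> L}) p d :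
  p \is d.-homog -> grade_map e (fun=> 1%N) p = e p *: 'X^d.
Proof.
move=> hp; rewrite grade_mapE [in RHS](mpolyE p) rmorph_sum scaler_suml.
rewrite [LHS]big_seq [RHS]big_seq; apply: eq_bigr => m mp; congr (_ *: 'X^_).
have /dhomogP/(_ m mp) /= <- := hp.
by rewrite mdegE; apply: eq_bigr => i _; exact: mul1n.
Qed.

Lemma grade_map_Fpartial (L : fieldType) (e : {rmorphism {mpoly K[n]} -> L}) d :
  injective e ->
  grade_map e (fun=> 1%N) (Fpartial t y d) =
  hl_gen (e t%:MP) (fun i => e (y i)%:MP) (fun i => e 'X_i) d.+1 setT setT.
Proof.
move=> e_inj; pose f : {rmorphism K -> L} := e \o @mpolyC n K.
have x_inj : injective (fun i => e ('X_i : {mpoly K[n]})).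
  by move=> i j /e_inj /mpolyXU_inj.
rewrite Fpartial_parts /= cardsT card_ord [in LHS]/grade_map rmorph_sum.
apply: eq_big_seq => la; rewrite mem_parts => /andP[sz _].
rewrite (insubT (fun s => size s == n) sz) /=; set l : n.-tuple nat := Sub la sz.
rewrite -[mmap _ _ _]/(grade_map e (fun=> 1%N) _).
rewrite (grade_map_homog e (d := sumn la)); last first.
  rewrite dhomogZ // (_ : sumn la = \sum_(i < n) tnth l i)%N ?HL_homog //.
  by rewrite sumnE -[X in \sum_(i <- X) _]/(tval l) big_tuple.
congr (_ *: _); rewrite -mul_mpolyC rmorphM /=.
have -> : e (HL t l) = mmap f (fun i => e 'X_i) (HL t l).
  rewrite [in LHS](mpolyE (HL t l)) rmorph_sum; apply: eq_bigr => m _.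
  rewrite -mul_mpolyC rmorphM; congr (_ * _).
  by rewrite mpolyXE_id rmorph_prod; apply: eq_bigr => i _; rewrite rmorphXn.
rewrite (mmap_HL t f l x_inj) /meval (mmap_HL t idfun l y_inj) /=.
have -> : HLnorm t l = multprod (vfact t) la by [].
have -> : weight t l = multprod (qfact t) la by [].
rewrite -[e t%:MP]/(f t) norm_coef_rmorph (hlsym_rmorph f t y) /norm_coef.
rewrite -[e _%:MP]/(f _) !(rmorphM f) !fmorphV (rmorphXn f) -exprVn.
by rewrite -[e (multprod _ _)%:MP]/(f _); ring.
Qed.

Lemma grade_map_Fden (L : fieldType) (e : {rmorphism {mpoly K[n]} -> L}) :
  grade_map e (fun=> 1%N) Fden =
  kernel_den (fun i => e (y i)%:MP) (fun i => e 'X_i) setT setT.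
Proof.
rewrite /Fden exchange_big /grade_map rmorph_prod /kernel_den.
apply: eq_big => [i|i _]; first by rewrite inE.
rewrite rmorph_prod; apply: eq_big => [j|j _]; first by rewrite inE.
by rewrite -[LHS]/(grade_map e (fun=> 1%N) (1 - y i *: 'X_j)) grade_map_lin /lin scaleNr.
Qed.

Lemma grade_map_Fnum (L : fieldType) (e : {rmorphism {mpoly K[n]} -> L}) :
  grade_map e (fun=> 1%N) Fnum =
  kernel_num (e t%:MP) (fun i => e (y i)%:MP) (fun i => e 'X_i) setT setT.
Proof.
pose f : {rmorphism K -> L} := e \o @mpolyC n K.
rewrite /Fnum /grade_map rmorph_sum /kernel_num.
apply: eq_big => [B|B _]; first by rewrite subsetT.
rewrite /= mmapZ rmorph_prod mul_polyC setTD; congr (_ *: _).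
  rewrite -[e t%:MP]/(f t) qcoef_rmorph (cross_rmorph f t y) -(rmorphM f) //.
apply: eq_big => [i|i _]; first by rewrite inE.
rewrite rmorph_prod; apply: eq_big => [j|j _]; first by rewrite inE.
rewrite -[LHS]/(grade_map e (fun=> 1%N) (1 - (_ * y i) *: 'X_j)).
rewrite grade_map_lin /lin scaleNr.
by rewrite mpolyCM rmorphM; case: ifP => // _; rewrite rmorph1.
Qed.

Theorem Fden_Fpartial d m : (mdeg m <= d)%N -> (Fden * Fpartial t y d)@_m = Fnum@_m.
Proof.
move=> md; have [L [e e_inj]] := mpoly_embedding K n.
pose f : {rmorphism K -> L} := e \o @mpolyC n K.
apply/eqP; rewrite -subr_eq0 -mcoeffB; apply/eqP.
apply: (coef_grade_map_eq0 e_inj (a := fun=> 1%N) (d := mdeg m)); last first.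
  by rewrite /wdeg mdegE; apply: eq_bigr => i _; exact: mul1n.
have -> : grade_map e (fun=> 1%N) (Fden * Fpartial t y d - Fnum) =
    grade_map e (fun=> 1%N) Fden * grade_map e (fun=> 1%N) (Fpartial t y d) -
    grade_map e (fun=> 1%N) Fnum by rewrite /grade_map rmorphB rmorphM.
rewrite grade_map_Fden grade_map_Fnum grade_map_Fpartial //.
set p := _ - _; suff /dvdpP[q ->] : dvdp 'X^(d.+1) p by rewrite coefMXn ltnS md.
apply: hl_gen_congr => //.
- by move=> i j /(fmorph_inj f) /y_inj.
- by move=> i; rewrite (fmorph_eq0 f).
- by move=> i j /e_inj /mpolyXU_inj.
- by move=> i; rewrite -(rmorph0 e) (inj_eq e_inj) mpolyXU_neq0.
by move=> k k0; rewrite -[e _]/(f t) -rmorphXn -(rmorph1 f) -rmorphB (fmorph_eq0 f) t_gen.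
Qed.

Lemma mps_mulp_Fseries p d m : (mdeg m <= d)%N ->
  mps_mulp p (Fseries t y) m = (p * Fpartial t y d)@_m.
Proof.
move=> md; apply: mps_mulpE => k km; apply: Fseries_sum; exact: leq_trans km md.
Qed.

Lemma mps_mulp_Fden m : mps_mulp Fden (Fseries t y) m = Fnum@_m.
Proof. by rewrite (mps_mulp_Fseries _ (leqnn _)) Fden_Fpartial. Qed.

(** An associativity law, needed because the denominator at x_n = 1 / (t y_n) is the [Fden] of one
    variable fewer times a further factor. *)
Lemma mps_mulpM_Fden p m : mps_mulp (p * Fden) (Fseries t y) m = (p * Fnum)@_m.
Proof.
rewrite (mps_mulp_Fseries _ (leqnn _)) -mulrA.
rewrite -(@mps_mulpE _ _ p _ (fun k => Fnum@_k)) => [|k]; last exact: Fden_Fpartial.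
by apply: mps_mulpE.
Qed.

Lemma Fseries_sym : mps_symmetric (Fseries t y).
Proof.
move=> s m; set m' := [multinom _ | _ < _].
have mm' : mdeg m' = mdeg m.
  rewrite !mdegE [RHS](reindex_inj (@perm_inj _ s)); apply: eq_bigr => i _.
  by rewrite mnmE.
rewrite /Fseries mm' -mcoeff_sym; congr (_@_m).
rewrite /Fpartial raddf_sum; apply: eq_bigr => l _ /=.
by rewrite msymZ msym_HL.
Qed.

End NumDen.

Section LastVariable.
Variables (K : fieldType) (n : nat).
Notation w := (widen_ord (leqnSn n)).

Lemma widen_ordS_inj : injective w.
Proof. by move=> i j /(congr1 val) /= /val_inj. Qed.

Lemma widen_ordS_neq_max i : (w i == ord_max) = false.
Proof. by apply/eqP => /(congr1 val) /= E; have := ltn_ord i; rewrite E ltnn. Qed.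

Lemma unlift_widen_ordS i : unlift ord_max (w i) = Some i.
Proof.
have -> : w i = lift ord_max i by apply/val_inj; rewrite /= /bump leqNgt ltn_ord.
exact: liftK.
Qed.

Lemma eval_lastX a k : mpoly_eval_last a ('X_[k] : {mpoly K[n.+1]}) =
  a ^+ k ord_max *: 'X_[[multinom k (w i) | i < n]].
Proof.
rewrite /mpoly_eval_last comp_mpolyX big_ord_recr /= !tnth_mktuple unlift_none.
rewrite mulrC -rmorphXn mul_mpolyC; congr (_ *: _); rewrite mpolyXE_id.
by apply: eq_bigr => i _; rewrite tnth_mktuple unlift_widen_ordS mnmE.
Qed.

Lemma mnm_last_eq (m : 'X_{1..n}) (k : 'X_{1..n.+1}) j :
  (k == (mnmwiden m + U_(ord_max) *+ j)%MM) =
  ([multinom k (w i) | i < n] == m) && (k ord_max == j).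
Proof.
apply/eqP/andP => [->|[/eqP<- /eqP<-]].
  split; last by rewrite mnmDE mulmnE mnm1E eqxx mnmwiden_ordmax mul1n.
  apply/eqP/mnmP => i; rewrite mnmE mnmDE mulmnE mnm1E eq_sym.
  rewrite widen_ordS_neq_max mul0n addn0.
  exact: mnmwiden_widen.
apply/mnmP => i; rewrite mnmDE mulmnE mnm1E.
case: (unliftP ord_max i) => [j'|] ->; last by rewrite eqxx mnmwiden_ordmax mul1n.
have -> : lift ord_max j' = w j' by apply/val_inj; rewrite /= /bump leqNgt ltn_ord.
by rewrite eq_sym widen_ordS_neq_max mul0n addn0 mnmwiden_widen mnmE.
Qed.

(** The degree bound ensures that the finite sum in [eval_last] meets every monomial of p. *)
Lemma eval_last_poly d a (p : {mpoly K[n.+1]}) m : deg_last_le (mps_poly p) d ->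
  eval_last d a (mps_poly p) m = (mpoly_eval_last a p)@_m.
Proof.
move=> pd; rewrite /eval_last /mps_poly.
transitivity (\sum_(k <- msupp p) p@_k *
    (a ^+ k ord_max * ([multinom k (w i) | i < n] == m)%:R)); last first.
  have -> : mpoly_eval_last a p =
      \sum_(k <- msupp p) p@_k *: mpoly_eval_last a 'X_[k].
    rewrite [in LHS](mpolyE p) /mpoly_eval_last (raddf_sum (comp_mpoly _)).
    by apply: eq_bigr => k _; exact: comp_mpolyZ.
  rewrite raddf_sum; apply: eq_bigr => k _ /=.
  by rewrite mcoeffZ eval_lastX mcoeffZ mcoeffX.
transitivity (\sum_(j < d.+1) \sum_(k <- msupp p) p@_k * a ^+ j *
    (k == (mnmwiden m + U_(ord_max) *+ j)%MM)%:R).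
  apply: eq_bigr => j _; rewrite {1}[p]mpolyE raddf_sum mulr_suml /=.
  apply: eq_bigr => k _; rewrite mcoeffZ mcoeffX; ring.
rewrite exchange_big [LHS]big_seq [RHS]big_seq; apply: eq_bigr => k kp.
have kd : (k ord_max < d.+1)%N.
  by rewrite ltnNge; apply: contraL kp => /pd pk; rewrite mcoeff_msupp negbK; apply/eqP.
rewrite (bigD1 (Ordinal kd)) //= mnm_last_eq eqxx andbT big1 ?addr0; first by ring.
move=> j jk; rewrite mnm_last_eq [X in _ && X](_ : _ = false) ?andbF ?mulr0 //.
by apply: contraNF jk => /eqP E; apply/eqP/val_inj.
Qed.

End LastVariable.

(** * Upper bound for the degree in the last variable *)

Section Degree.
Variables (K : fieldType) (t : K) (n : nat) (y : 'I_n.+1 -> K).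
Hypothesis y_inj : injective y.
Hypothesis y_neq0 : forall i, y i != 0.

(** In its last variable the numerator is a multiple of [kernel_poly] for all n + 1 of the y and the
    other n of the x. Its top coefficient is a multiple of [kernel 1] for these two sets, hence
    zero. *)
Lemma Fnum_deg_le : deg_last_le (mps_poly (Fnum t y)) n.
Proof.
move=> m mn; have [L [e e_inj]] := mpoly_embedding K n.+1.
pose f : {rmorphism K -> L} := e \o @mpolyC n.+1 K.
pose dg (i : 'I_n.+1) : nat := (i == ord_max).
apply: (coef_grade_map_eq0 e_inj (a := dg) (d := m ord_max)); last first.
  rewrite /wdeg (bigD1 ord_max) //= /dg eqxx mul1n big1 ?addn0 // => i /negPf->.
  exact: mul0n.
pose a i := f (y i); pose b i := e ('X_i : {mpoly K[n.+1]}).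
pose B' : {set 'I_n.+1} := [set~ ord_max].
have a_inj : injective a by move=> i j /(fmorph_inj f) /y_inj.
have a_neq0 i : a i != 0 by rewrite (fmorph_eq0 f).
have b_inj : injective b by move=> i j /e_inj /mpolyXU_inj.
have b_neq0 i : b i != 0 by rewrite -(rmorph0 e) (inj_eq e_inj) mpolyXU_neq0.
have ab_neq1 i j : a i * b j != 1.
  rewrite -(rmorph1 e) -[a i * b j](rmorphM e) (inj_eq e_inj) mul_mpolyC.
  apply/eqP => /(congr1 (mcoeff 0%MM)); rewrite mcoeffZ mcoeffX mcoeff1 eqxx.
  have -> : (U_(j)%MM == 0%MM :> 'X_{1..n.+1}) = false.
    by apply/eqP => /(congr1 mdeg); rewrite mdeg1 mdeg0.
  by rewrite mulr0 => /esym/eqP; rewrite oner_eq0.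
(* The prefactor clears the denominators of [pairing]; ['X] is scaled because [grade_map] also keeps
   the last variable in the coefficients. *)
have -> : grade_map e dg (Fnum t y) =
    (\prod_i \prod_(j in B') (1 - a i * b j))%:P *
    (kernel_poly (f t) a b (f t) setT B' \Po (b ord_max *: 'X)).
  rewrite /grade_map rmorph_sum /kernel_poly raddf_sum mulr_sumr /=.
  apply: eq_big => [B|B _]; first by rewrite subsetT.
  rewrite mmapZ comp_polyM comp_polyC -[X in X * _ = _]/((f (Fnum_coef t y B))%:P).
  rewrite setTD /Fnum_coef (rmorphM f) -qcoef_rmorph -cross_rmorph.
  rewrite -/a [(_ * pairing _ _ _ _ _)%:P]polyCM mulrCA -!mulrA; congr (_ * _).
  rewrite rmorph_prod mulrA -polyCM [X in X%:P * _]mulrC.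
  have -> : \prod_i \prod_(j in B') (1 - a i * b j) * pairing (f t) a b B B' =
     \prod_i \prod_(j in B') (1 - (if i \in B then f t else 1) * a i * b j).
    have -> : pairing (f t) a b B B' = \prod_i (if i \in B then
        \prod_(j in B') ((1 - f t * a i * b j) / (1 - a i * b j)) else 1).
      by rewrite /pairing big_mkcond.
    rewrite -big_split; apply: eq_bigr => i _ /=; case: ifP => _; last first.
      by rewrite mulr1; apply: eq_bigr => j _; rewrite mul1r.
    rewrite -big_split; apply: eq_bigr => j _ /=.
    by rewrite mulrC divfK // subr_eq0 eq_sym.
  rewrite (rmorph_prod (comp_poly _)) rmorph_prod.
  rewrite [X in _ = _ * X](_ : _ = \prod_(i < n.+1)
     (lin 1 (- ((if i \in B then f t else 1) * a i)) \Po (b ord_max *: 'X))); last first.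
    by apply: eq_bigl => i; rewrite inE.
  rewrite -big_split; apply: eq_bigr => i _ /=.
  rewrite rmorph_prod (bigD1 ord_max) //= mulrC; congr (_ * _).
    rewrite rmorph_prod; apply: eq_big => [j|j jm]; first by rewrite !inE.
    rewrite -[LHS]/(grade_map e dg (1 - (_ * y i) *: 'X_j)) grade_map_lin /dg (negPf jm).
    rewrite expr0 alg_polyC [RHS]rmorphB rmorph1; congr (_ - polyC (_ * _)).
    by rewrite -[e _]/(f _) rmorphM /a; case: ifP => // _; rewrite rmorph1.
  rewrite -[LHS]/(grade_map e dg (1 - (_ * y i) *: 'X_ord_max)).
  rewrite grade_map_lin /dg eqxx expr1.
  rewrite /lin comp_polyD comp_polyC comp_polyZ comp_polyX scalerA mulNr scaleNr.
  congr (_ - (_ * _) *: _).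
  by rewrite -[e _]/(f _) rmorphM /a; case: ifP => // _; rewrite rmorph1.
apply: nth_default; rewrite mul_polyC (leq_trans (size_scale_leq _ _)) //.
rewrite size_comp_poly2; last by rewrite size_scale ?b_neq0 ?size_polyX.
apply: leq_trans mn; rewrite -[X in (_ <= X)%N](card_ord n.+1) -cardsT.
apply: size_kernel_poly_lt; apply: kernel1_eq0 => //.
by rewrite cardsC1 cardsT card_ord.
Qed.

End Degree.

(** * The degree in the last variable is attained *)

Section Specialization.
Variables (K : fieldType) (t : K) (n : nat) (y : 'I_n.+1 -> K).
Notation w := (widen_ord (leqnSn n)).

Hypothesis y_inj : injective y.
Hypothesis y_neq0 : forall i, y i != 0.
Hypothesis t_neq0 : t != 0.
Hypothesis ty_neq : forall i j, t * y i != y j.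

Lemma mmap_Fnum (M : comNzRingType) (h : {rmorphism K -> M}) (x : 'I_n.+1 -> M) :
  mmap h x (Fnum t y) = \sum_(B : {set 'I_n.+1}) h (Fnum_coef t y B) *
    \prod_i \prod_j (1 - h ((if i \in B then t else 1) * y i) * x j).
Proof.
rewrite /Fnum (raddf_sum (mmap h x)); apply: eq_bigr => B _.
rewrite /= mmapZ rmorph_prod; congr (_ * _); apply: eq_bigr => i _.
rewrite rmorph_prod; apply: eq_bigr => j _ /=.
by rewrite rmorphB rmorph1 /= mmapZ mmapX mmap1U.
Qed.

Lemma prod2_eq0 (f : 'I_n.+1 -> 'I_n.+1 -> K) i j : f i j = 0 ->
  \prod_i \prod_j f i j = 0.
Proof.
move=> fij; apply/eqP/prodf_eq0; exists i => //; apply/prodf_eq0; exists j => //.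
exact/eqP.
Qed.

(* At the points x_i = 1 / (t y_i) for i < n, only the terms B = set0 and
   B = [set ord_max] of the numerator survive, and both vanish when moreover
   x_n = 1 / y_j with j < n. *)
Definition test_point (z : K) i := if i == ord_max then z else (t * y i)^-1.

Lemma Fnum_test_eq0 j : j != ord_max ->
  mmap idfun (test_point (y j)^-1) (Fnum t y) = 0.
Proof.
move=> jm; rewrite mmap_Fnum big1 // => B _; apply/eqP; rewrite mulf_eq0; apply/orP; right.
have [/existsP[i /andP[im iB]]|] := boolP [exists i, (i != ord_max) && (i \in B)].
  apply/eqP/(@prod2_eq0 _ i i); rewrite /test_point (negPf im) iB /= divff ?subrr //.
  by rewrite mulf_neq0.
move/existsPn/(_ j); rewrite jm /= => /negPf jB.
apply/eqP/(@prod2_eq0 _ j ord_max); rewrite /test_point eqxx jB /= mul1r divff ?subrr //.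
Qed.

Lemma Fnum_test_neq0 : mmap idfun (test_point (y ord_max)^-1) (Fnum t y) != 0.
Proof.
have t1 : t != 1.
  by have := ty_neq ord_max ord_max; apply: contra => /eqP->; rewrite mul1r.
rewrite mmap_Fnum (bigD1 [set ord_max]) //= [X in _ + X]big1 ?addr0; last first.
  move=> B Bm; apply/eqP; rewrite mulf_eq0; apply/orP; right; apply/eqP.
  have [mB|/negPf mB] := boolP (ord_max \in B); last first.
    apply: (@prod2_eq0 _ ord_max ord_max).
    by rewrite /test_point eqxx mB mul1r divff ?subrr.
  have [i iB im] : exists2 i, i \in B & i != ord_max.
    apply/exists_inP; apply: contraNT Bm => /exists_inPn h; apply/eqP/setP => i.
    rewrite inE; apply/idP/eqP => [/h|-> //]; by rewrite negbK => /eqP.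
  apply: (@prod2_eq0 _ i i); rewrite /test_point (negPf im) iB divff ?subrr //.
  by rewrite mulf_neq0.
have tyN i j : (i != j) || (t != 1) -> 1 - y i / (t * y j) != 0.
  move=> _; rewrite subr_eq0; apply/eqP => /(congr1 ( *%R^~ (t * y j))).
  rewrite mul1r divfK ?mulf_neq0 // => /eqP; exact/negP.
apply: mulf_neq0; first apply: mulf_neq0.
- by rewrite /qcoef mulf_neq0 ?expf_neq0 ?oppr_eq0.
- rewrite /cross; apply/prodf_neq0 => i /set1P->; apply/prodf_neq0 => j.
  rewrite !inE => jm; rewrite mulf_neq0 ?invr_eq0 ?subr_eq0 1?eq_sym //.
  by rewrite (inj_eq y_inj).
apply/prodf_neq0 => i _; apply/prodf_neq0 => j _; rewrite inE /test_point.
case: (eqVneq i ord_max) => [->|im]; case: (eqVneq j ord_max) => [_|jm].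
- by rewrite mulfK // subr_eq0 eq_sym.
- by rewrite -mulf_div divff // mul1r subr_eq0 eq_sym; apply/eqP => /divr1_eq/eqP;
    rewrite (inj_eq y_inj) eq_sym (negPf jm).
- rewrite mul1r subr_eq0 eq_sym; apply/eqP => /divr1_eq/eqP.
  by rewrite (inj_eq y_inj) (negPf im).
by rewrite mul1r tyN // t1 orbT.
Qed.

(** If the degree were below n, setting x_i = 1 / (t y_i) for i < n would leave a polynomial in x_n
    of degree below n with the n zeros 1 / y_j for j < n. It would be zero, against its value at 1 /
    y_n. *)
Lemma Fnum_deg_last : deg_last_le (mps_poly (Fnum t y)) n ->
  exists m : 'X_{1..n.+1}, m ord_max = n /\ (Fnum t y)@_m != 0.
Proof.
move=> num_le.
have [/hasP[m mn /eqP mm]|/hasPn no] :=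
  boolP (has (fun m : 'X_{1..n.+1} => m ord_max == n) (msupp (Fnum t y))).
  by exists m; rewrite -mcoeff_msupp.
pose x i : {poly K} := if i == ord_max then 'X else ((t * y i)^-1)%:P.
pose p := mmap polyC x (Fnum t y).
have pE z : p.[z] = mmap idfun (test_point z) (Fnum t y).
  rewrite /p /mmap horner_sum; apply: eq_bigr => m _.
  rewrite hornerM hornerC /mmap1 horner_prod; congr (_ * _); apply: eq_bigr => i _.
  by rewrite horner_exp /x /test_point; case: ifP => _; rewrite ?hornerX ?hornerC.
have sp : (size p <= n)%N.
  rewrite /p /mmap big_seq.
  apply: (big_ind (fun q : {poly K} => (size q <= n)%N)).
  - by rewrite size_poly0.
  - by move=> q1 q2 h1 h2; rewrite (leq_trans (size_polyD _ _)) // geq_max h1.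
  move=> m mn; rewrite mul_polyC (leq_trans (size_scale_leq _ _)) //.
  rewrite /mmap1 (bigD1 ord_max) //= {1}/x eqxx.
  rewrite [X in 'X^_ * X](_ : _ =
      (\prod_(i < n.+1 | i != ord_max) (t * y i)^-1 ^+ m i)%:P).
    rewrite mulrC mul_polyC (leq_trans (size_scale_leq _ _)) // size_polyXn.
    rewrite ltn_neqAle no //= leqNgt; apply: contraL mn => /num_le E.
    by rewrite mcoeff_msupp negbK; apply/eqP.
  by rewrite rmorph_prod; apply: eq_bigr => i /negPf im; rewrite /x im /= polyC_exp.
have p0 : p = 0.
  apply: (@roots_geq_poly_eq0 _ _ [seq (y i)^-1 | i <- enum [set~ (ord_max : 'I_n.+1)]]).
  - apply/allP => _ /mapP[i im ->]; rewrite mem_enum !inE in im.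
    by rewrite rootE pE Fnum_test_eq0.
  - by rewrite map_inj_uniq ?enum_uniq // => i j /invr_inj /y_inj.
  by rewrite size_map -cardE cardsC1 card_ord.
by have := Fnum_test_neq0; rewrite -pE p0 horner0 eqxx.
Qed.

End Specialization.

(** * Numerator and denominator at x_n = 1 / (t y_n) *)

Section Residue.
Variables (K : fieldType) (t : K) (n : nat) (y : 'I_n.+1 -> K).
Notation w := (widen_ord (leqnSn n)).
Let y' i := y (w i).
Let a := (t * y ord_max)^-1.

Hypothesis y_inj : injective y.
Hypothesis y_neq0 : forall i, y i != 0.
Hypothesis t_neq0 : t != 0.

(** The product of the factors of [Fden y] involving the last x or the last y, taken at last x = a.
    It also splits off from the numerator and so drops out of the quotient. *)
Definition eval_factor : {mpoly K[n]} :=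
  (\prod_j (1 - y j * a))%:MP * \prod_(j < n) (1 - y ord_max *: 'X_j).

Let x i : {mpoly K[n]} := if unlift ord_max i is Some j then 'X_j else a%:MP.

Lemma eval_lastE p : mpoly_eval_last a p = mmap (@mpolyC n K) x p.
Proof.
rewrite /mpoly_eval_last /comp_mpoly /mmap; apply: eq_bigr => m _; congr (_ * _).
by apply: eq_bigr => i _; rewrite tnth_mktuple.
Qed.

Lemma x_w i : x (w i) = 'X_i.
Proof. by rewrite /x unlift_widen_ordS. Qed.

Lemma x_max : x ord_max = a%:MP.
Proof. by rewrite /x unlift_none. Qed.

Lemma sub1C (c d : K) : 1 - c%:MP_[n] * d%:MP_[n] = (1 - c * d)%:MP.
Proof. by rewrite rmorphB rmorph1 rmorphM. Qed.

Lemma eval_last_Fden : mpoly_eval_last a (Fden y) = eval_factor * Fden y'.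
Proof.
rewrite eval_lastE /Fden rmorph_prod big_ord_recr /=.
have E i j : mmap (@mpolyC n K) x (1 - y j *: 'X_i) = 1 - (y j)%:MP * x i.
  by rewrite rmorphB rmorph1 /= mmapZ mmapX mmap1U.
have Ew i : mmap (@mpolyC n K) x (\prod_(j < n.+1) (1 - y j *: 'X_(w i))) =
    \prod_(j < n) (1 - y' j *: 'X_i) * (1 - y ord_max *: 'X_i).
  rewrite rmorph_prod big_ord_recr /= E x_w mul_mpolyC; congr (_ * _).
  by apply: eq_bigr => j _; rewrite E x_w mul_mpolyC.
have Em : mmap (@mpolyC n K) x (\prod_(j < n.+1) (1 - y j *: 'X_ord_max)) =
    (\prod_j (1 - y j * a))%:MP.
  by rewrite !rmorph_prod; apply: eq_bigr => j _; rewrite /= E x_max sub1C.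
rewrite Em (eq_bigr _ (fun i _ => Ew i)) big_split /eval_factor /=; ring.
Qed.

Lemma max_notin_imset (B : {set 'I_n}) : ord_max \notin w @: B.
Proof. by apply/imsetP => -[i _] /esym/eqP; rewrite widen_ordS_neq_max. Qed.

Lemma setC_imset_widen_ordS (B : {set 'I_n}) : ~: (w @: B) = ord_max |: w @: (~: B).
Proof.
apply/setP => i; rewrite !inE.
case: (unliftP ord_max i) => [j|] ->; last by rewrite eqxx max_notin_imset.
have -> : lift ord_max j = w j by apply/val_inj; rewrite /= /bump leqNgt ltn_ord.
by rewrite widen_ordS_neq_max !mem_imset ?inE //; apply: widen_ordS_inj.
Qed.

(** For i in B, the factor of [cross] against the last index times 1 - t y_i a equals t (1 - y_i a),
    giving t ^+ #|B| in all; [qcoefS] supplies the remaining -t * t ^+ #|~: B|. *)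
Lemma Fnum_coef_imset (B : {set 'I_n}) :
  Fnum_coef t y (w @: B) *
    (\prod_(i < n) (1 - (if i \in B then t else 1) * y' i * a) * (1 - y ord_max * a)) =
  - t ^+ n.+1 * (\prod_j (1 - y j * a) * Fnum_coef t y' B).
Proof.
have cw (I J : {set 'I_n}) : cross t y (w @: I) (w @: J) = cross t y' I J.
  rewrite /cross big_imset /=; last by move=> ? ? _ _; apply: widen_ordS_inj.
  by apply: eq_bigr => i _; rewrite big_imset //= => ? ? _ _; apply: widen_ordS_inj.
have Cr : cross t y (w @: B) (~: (w @: B)) =
    \prod_(i in B) ((y' i - t * y ord_max) / (y' i - y ord_max)) * cross t y' B (~: B).
  rewrite setC_imset_widen_ordS crossU1r ?max_notin_imset // cw big_imset //.
  by move=> ? ? _ _; apply: widen_ordS_inj.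
have Cn : \prod_j (1 - y j * a) = \prod_(i < n) (1 - y' i * a) * (1 - y ord_max * a).
  by rewrite big_ord_recr.
rewrite Cn /Fnum_coef Cr setC_imset_widen_ordS cardsU1 max_notin_imset add1n.
rewrite card_imset; last exact: widen_ordS_inj.
rewrite qcoefS.
have E : \prod_(i in B) ((y' i - t * y ord_max) / (y' i - y ord_max)) *
    \prod_(i < n) (1 - (if i \in B then t else 1) * y' i * a) =
    t ^+ #|B| * \prod_(i < n) (1 - y' i * a).
  rewrite -prodr_const big_mkcond /= [X in _ = X * _]big_mkcond -!big_split /=.
  apply: eq_bigr => i _; case: ifP => _; last by rewrite !mul1r.
  rewrite /a; field.
  rewrite y_neq0 t_neq0 /= subr_eq0 (inj_eq y_inj) widen_ordS_neq_max //.
have -> : t ^+ n.+1 = t * (t ^+ #|B| * t ^+ #|~: B|).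
  by rewrite exprS -exprD cardsC card_ord.
set P := \prod_(i < n) (1 - y' i * a) in E *.
set Q := \prod_(i < n) _ in E *.
set R := \prod_(i in B) _ in E *.
transitivity (- t * t ^+ #|~: B| * qcoef t t #|~: B| * cross t y' B (~: B) *
  (1 - y ord_max * a) * (R * Q)); first by ring.
by rewrite E; ring.
Qed.

(** Sets containing the last index vanish because t * y ord_max * a = 1; the others are images of
    subsets of the first n indices. *)
Lemma eval_last_Fnum :
  mpoly_eval_last a (Fnum t y) = - t ^+ n.+1 *: (eval_factor * Fnum t y').
Proof.
rewrite eval_lastE mmap_Fnum (bigID (fun B : {set 'I_n.+1} => ord_max \notin B)) /=.
rewrite [X in _ + X]big1 ?addr0; last first.
  move=> B; rewrite negbK => mB; rewrite (bigD1 ord_max) //= (bigD1 ord_max) //= mB x_max.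
  by rewrite sub1C /a divff ?mulf_neq0 // subrr mpolyC0 !mul0r mulr0.
rewrite (reindex_onto (fun B : {set 'I_n} => w @: B) (fun B => w @^-1: B)) /=; last first.
  move=> B mB; apply/setP => i; apply/imsetP/idP => [[j]|iB].
    by rewrite inE => jB ->.
  case: (unliftP ord_max i) iB => [j|] -> iB; last by rewrite iB in mB.
  have E : lift ord_max j = w j by apply/val_inj; rewrite /= /bump leqNgt ltn_ord.
  by exists j => //; rewrite inE -E.
rewrite /Fnum mulr_sumr scaler_sumr; apply: eq_big => [B|B _].
  rewrite max_notin_imset /=; apply/eqP/setP => i.
  by rewrite inE mem_imset //; apply: widen_ordS_inj.
have inB i : (w i \in w @: B) = (i \in B) by rewrite mem_imset //; apply: widen_ordS_inj.
rewrite big_ord_recr /= (negPf (max_notin_imset B)) mul1r.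
rewrite [X in _ * (_ * X)]big_ord_recr /= x_max sub1C.
rewrite [X in _ * (_ * (X * _))](_ : _ =
    \prod_(j < n) (1 - y ord_max *: 'X_j)); last first.
  by apply: eq_bigr => j _; rewrite x_w mul_mpolyC.
rewrite [X in _ * (X * _)](_ : _ = \prod_(i < n) \prod_(j < n)
     (1 - ((if i \in B then t else 1) * y' i) *: 'X_j) *
   (\prod_(i < n) (1 - (if i \in B then t else 1) * y' i * a))%:MP); last first.
  rewrite rmorph_prod -big_split; apply: eq_bigr => i _ /=.
  rewrite big_ord_recr /= x_max sub1C inB; congr (_ * _).
  by apply: eq_bigr => j _; rewrite x_w mul_mpolyC.
set Z := \prod_(i < n) \prod_(j < n) _; set Y := \prod_(j < n) (1 - y ord_max *: 'X_j).
rewrite -!mul_mpolyC /eval_factor -/Y.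
move: (Fnum_coef_imset B).
move: (Fnum_coef t y (w @: B)) (Fnum_coef t y' B) (1 - y ord_max * a)
  (\prod_(i < n) (1 - (if i \in B then t else 1) * y' i * a))
  (\prod_j (1 - y j * a)) (- t ^+ n.+1) => c1 c2 c3 c4 c5 c6.
move=> /(congr1 (@mpolyC n K)); rewrite !mpolyCM => E.
transitivity (c1%:MP * (c4%:MP * c3%:MP) * (Z * Y)); first by ring.
by rewrite E; ring.
Qed.

End Residue.

(** * Specialization of the last variable, and the case n = 1 *)

Section Series.
Variables (K : fieldType) (t : K).
Hypothesis t_neq0 : t != 0.
Hypothesis t_gen : forall k, (0 < k)%N -> 1 - t ^+ k != 0.

Lemma mps_mulp_scale n (p : {mpoly K[n]}) c f m :
  mps_mulp p (mps_scale c f) m = c * mps_mulp p f m.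
Proof. by rewrite /mps_mulp mulr_sumr; apply: eq_bigr => k _; rewrite mulrCA. Qed.

Lemma mcoeff0_lin n c i : (1 - c *: 'X_i : {mpoly K[n]})@_0%MM = 1.
Proof.
rewrite mcoeffB mcoeff1 eqxx mcoeffZ mcoeffX.
have -> : (U_(i)%MM == 0%MM :> 'X_{1..n}) = false.
  by apply/eqP => /(congr1 mdeg); rewrite mdeg1 mdeg0.
by rewrite mulr0 subr0.
Qed.

Lemma mcoeff0_prod1 n (I : finType) (f : I -> {mpoly K[n]}) :
  (forall i, (f i)@_0%MM = 1) -> (\prod_i f i)@_0%MM = 1.
Proof.
move=> f1; elim/big_rec: _ => [|i p _ IH]; first by rewrite mcoeff1 eqxx.
by rewrite rmorphM /= f1 IH mulr1.
Qed.

Lemma Fseries_subst n (y : 'I_n.+1 -> K) :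
  injective y -> (forall i, y i != 0) -> (forall i j, t * y i != y j) ->
  subst_last (Fseries t y) (t * y ord_max)^-1
    (mps_scale (- t ^+ n.+1) (Fseries t (fun i : 'I_n => y (widen_ord (leqnSn n) i)))).
Proof.
move=> y_inj y_neq0 ty_neq; exists (Fden y), n; split.
- move=> m mn; rewrite mps_mulp_Fden //; exact: (Fnum_deg_le t y_inj y_neq0 mn).
- rewrite eval_last_Fden /eval_factor !rmorphM /= mcoeffC eqxx mulr1.
  rewrite mcoeff0_prod1 => [|j]; last exact: mcoeff0_lin.
  rewrite mcoeff0_prod1 => [|i]; last first.
    by apply: mcoeff0_prod1 => j; exact: mcoeff0_lin.
  rewrite !mulr1; apply/prodf_neq0 => j _; rewrite subr_eq0.
  apply/eqP => /esym/divr1_eq/eqP; by rewrite eq_sym (negPf (ty_neq _ _)).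
move=> m; rewrite mps_mulp_scale eval_last_Fden mps_mulpM_Fden //; last first.
  by move=> i j /y_inj /widen_ordS_inj.
rewrite (_ : eval_last _ _ _ m = eval_last n (t * y ord_max)^-1 (mps_poly (Fnum t y)) m).
  rewrite eval_last_poly; last exact: Fnum_deg_le.
  by rewrite eval_last_Fnum // mcoeffZ.
by apply: eq_bigr => k _; rewrite mps_mulp_Fden.
Qed.

(** The empty set contributes -t (1 - y x) and the full set 1 - t y x; the terms in x cancel. *)
Lemma Fnum_ord1 (y : 'I_1 -> K) : Fnum t y = (1 - t)%:MP.
Proof.
rewrite /Fnum (eq_bigl (fun B : {set 'I_1} => B \subset ord0 |: set0)); last first.
  by move=> B; apply/esym/subsetP => i _; rewrite !inE (ord1 i) eqxx.
rewrite big_subsetU1 ?inE // (big_pred1 set0); last by move=> B; rewrite subset0.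
rewrite /Fnum_coef !big_ord1 setU0 setC0 !inE eqxx.
have -> : ~: [set (ord0 : 'I_1)] = set0 by apply/setP => i; rewrite !inE (ord1 i).
rewrite cross0l cross0r cards0 cardsT card_ord /qcoef expr1 expr0 !mulr1 !mul1r.
by rewrite scale1r -!mul_mpolyC !mpolyCM mpolyCB mpolyC1 mpolyCN; ring.
Qed.

Lemma Fseries_ord1 (c : K) : c != 0 ->
  mps_frac (Fseries t (fun _ : 'I_1 => c)) (1 - t)%:MP (1 - c *: 'X_ord0).
Proof.
move=> c0; split; first by rewrite mcoeff0_lin oner_eq0.
move=> m; rewrite /mps_poly -(Fnum_ord1 (fun=> c)) -mps_mulp_Fden //.
- by rewrite /Fden !big_ord1.
- by move=> i j _; rewrite (ord1 i) (ord1 j).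
Qed.

End Series.

(** * Genericity of the indeterminates t and y_i *)

Section Variables.
Variables (k : fieldType) (n : nat).

Lemma tofrac_inj (R : idomainType) : injective (@tofrac R).
Proof. by move=> p q /eqP; rewrite tofrac_eq => /eqP. Qed.

Lemma tvar_neq0 : tvar k n != 0.
Proof. by rewrite tofrac_eq0 mpolyXU_neq0. Qed.

Lemma yvar_neq0 i : @yvar k n i != 0.
Proof. by rewrite tofrac_eq0 mpolyXU_neq0. Qed.

Lemma yvar_inj : injective (@yvar k n).
Proof. by move=> i j /tofrac_inj /mpolyXU_inj /lift_inj. Qed.

Lemma tvar_gen d : (0 < d)%N -> 1 - tvar k n ^+ d != 0.
Proof.
move=> d0; rewrite /tvar -rmorphXn -(rmorph1 (@tofrac _)) -rmorphB tofrac_eq0.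
apply/eqP => /(congr1 (mcoeff 0%MM)); rewrite mcoeffB mcoeff1 eqxx mcoeff0 mcoeffXn.
have -> : ((U_(ord0) *+ d)%MM == 0%MM :> 'X_{1..n.+1}) = false.
  apply/eqP => /(congr1 (fun m : 'X_{1..n.+1} => m ord0)).
  by rewrite mulmnE mnm1E eqxx mul1n mnm0E => d1; rewrite d1 in d0.
by rewrite subr0 => /eqP; rewrite oner_eq0.
Qed.

Lemma tvar_yvar_neq i j : tvar k n * @yvar k n i != @yvar k n j.
Proof.
rewrite /tvar /yvar -rmorphM /= tofrac_eq -mpolyXD.
apply/eqP => /(congr1 (mcoeff U_(lift ord0 j))); rewrite !mcoeffX eqxx.
have -> : ((U_(ord0) + U_(lift ord0 i))%MM == U_(lift ord0 j)%MM :> 'X_{1..n.+1}) = false.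
  by apply/eqP => /(congr1 mdeg); rewrite mdegD !mdeg1.
by move/esym/eqP; rewrite oner_eq0.
Qed.

End Variables.

Theorem theorem1 (k : fieldType) (n : nat) :
  let t := tvar k n.+1 in
  let y := @yvar k n.+1 in
  let F := Fseries t y in
  let F' := Fseries t (fun i : 'I_n => y (widen_ord (leqnSn n) i)) in
  let F1 := Fseries t (fun _ : 'I_1 => y ord0) in
  let D := \prod_(i < n.+1) \prod_(j < n.+1) (1 - y j *: 'X_i) in
  [/\ mps_symmetric F,
      deg_last (mps_mulp D F) n,
      subst_last F (t * y ord_max)^-1 (mps_scale (- t ^+ n.+1) F') &
      mps_frac F1 (1 - t)%:MP (1 - y ord0 *: 'X_ord0)].
Proof.
move=> t y F F' F1 D.
have t0 : t != 0 := tvar_neq0 k n.+1.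
have tg := @tvar_gen k n.+1.
have y0 := @yvar_neq0 k n.+1.
have yi : injective y := @yvar_inj k n.+1.
have ty : forall i j, t * y i != y j := @tvar_yvar_neq k n.+1.
have DF m : mps_mulp D F m = (Fnum t y)@_m by exact: mps_mulp_Fden.
split.
- exact: Fseries_sym.
- split=> [m mn|]; first by rewrite DF; exact: (Fnum_deg_le t yi y0 mn).
  have [m [mn m0]] := Fnum_deg_last yi y0 t0 ty (Fnum_deg_le t yi y0).
  by exists m; rewrite DF.
- exact: Fseries_subst.
exact: (Fseries_ord1 tg (y0 ord0)).
Qed.
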